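(* Let $m,d\in\mathbb{N}$ and let $\phi:[0,1]^{m}\times[0,1]\to\mathbb{R}^{d}$ be a family of rationally non-degenerate analytic curves of order $\kappa$, where $2\leq\kappa\leq\infty$. Let $\{\rho_{n}\}_{n=1}^{\infty}\subseteq\mathbb{R}$ with $\rho_{n}\to\infty$, and assume that \begin{itemize} \item if $\kappa<\infty$, then $\rho_{n}=o(n^{\kappa})$; \item if $\kappa=\infty$, then there exists $l\in\mathbb{N}$ such that $\rho_{n}=o(n^{l})$. \end{itemize} Let $\{\mathbf{x}_{n}\}_{n=1}^{\infty}\subseteq[0,1]^{m}$ be arbitrary, and put $\gamma_{n}(t)=\rho_{n}\phi(\mathbf{x}_{n},t)$ for $t\in[0,1]$. Then the sequence of probability measures \[ \mu_{n}=\frac{1}{n}\sum_{k=1}^{n}\delta_{\pi(\gamma_{n}(k/n))} \] on $\mathbb{T}^{d}=\mathbb{R}^{d}/\mathbb{Z}^{d}$ equidistributes.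
   Context: $\pi:\mathbb{R}^{d}\to\mathbb{R}^{d}/\mathbb{Z}^{d}$ is the natural projection. A sequence of probability measures $\mu_n$ on $\mathbb{T}^d$ equidistributes if $\lim_{n\to\infty}\mu_{n}(f)=\int_{\mathbb{T}^{d}}f\,d\mathbf{x}$ for all continuous $f$ on $\mathbb{T}^{d}$, where $d\mathbf{x}$ is normalized Haar measure. ''Analytic'' means real analytic (on a neighbourhood of the closed domain). For a smooth curve $\gamma:[0,1]\to\mathbb{R}^{d}$ and $j\in\mathbb{N}$, let $\gamma^{(j)}=(\gamma_{1}^{(j)},\dots,\gamma_{d}^{(j)})$ be the componentwise $j$-th derivative. $\gamma$ is rationally non-degenerate (RND) of order $\kappa\in\mathbb{N}\cup\{\infty\}$ if $\kappa=\sup\{j\in\mathbb{N}: \text{for every }\mathbf{h}\in\mathbb{Z}^{d}\setminus\{\mathbf{0}\},\ t\mapsto\langle\mathbf{h},\gamma^{(j)}(t)\rangle\text{ is not identically zero}\}$. A family $\phi:[0,1]^{m}\times[0,1]\to\mathbb{R}^{d}$ of smooth curves is RND of order $\kappa$ if $\kappa=\inf\{\text{order of }\phi(\mathbf{x},\cdot):\mathbf{x}\in[0,1]^{m}\}$. *)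

(* Defs.v *)
From Stdlib Require Import Reals ZArith.
From Coquelicot Require Import Coquelicot.
From mathcomp Require Import all_boot all_order all_algebra.
From mathcomp Require Import Rstruct.

Set Implicit Arguments.
Unset Strict Implicit.
Unset Printing Implicit Defensive.

Local Open Scope R_scope.

Definition rsum (I : finType) (F : I -> R) : R := (\sum_(i : I) F i)%R.
Definition rprod (I : finType) (F : I -> R) : R := (\prod_(i : I) F i)%R.
Definition rsum_nat (a b : nat) (F : nat -> R) : R := (\sum_(a <= k < b) F k)%R.

Definition in_cube (n : nat) (x : 'I_n -> R) : Prop :=
  forall i : 'I_n, 0 <= x i <= 1.

(* Real analyticity of F : R^m x R -> R at the point (p, s):
   F is given, on a neighbourhood of (p,s), by an absolutely convergent
   power series  sum_{a in N^m, b in N} c a b (x-p)^a (t-s)^b.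
   Partial sums are taken over the boxes {a_j <= K, b <= K}; absolute
   convergence makes the sum independent of the exhaustion.            *)
Definition ps_partial (m : nat) (c : ('I_m -> nat) -> nat -> R)
  (p : 'I_m -> R) (s : R) (x : 'I_m -> R) (t : R) (K : nat) : R :=
  rsum (fun a : {ffun 'I_m -> 'I_K.+1} =>
    rsum (fun b : 'I_K.+1 =>
      c (fun j => nat_of_ord (a j)) b *
      rprod (fun j : 'I_m => (x j - p j) ^ (a j)) * (t - s) ^ b)).

Definition ps_abs_partial (m : nat) (c : ('I_m -> nat) -> nat -> R)
  (p : 'I_m -> R) (s : R) (x : 'I_m -> R) (t : R) (K : nat) : R :=
  rsum (fun a : {ffun 'I_m -> 'I_K.+1} =>
    rsum (fun b : 'I_K.+1 =>
      Rabs (c (fun j => nat_of_ord (a j)) b) *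
      rprod (fun j : 'I_m => Rabs (x j - p j) ^ (a j)) * Rabs (t - s) ^ b)).

Definition analytic_at (m : nat) (F : ('I_m -> R) -> R -> R)
  (p : 'I_m -> R) (s : R) : Prop :=
  exists r : R, 0 < r /\
  exists c : ('I_m -> nat) -> nat -> R,
    forall (x : 'I_m -> R) (t : R),
      (forall j, Rabs (x j - p j) < r) -> Rabs (t - s) < r ->
      (exists M : R, forall K, ps_abs_partial c p s x t K <= M) /\
      is_lim_seq (fun K => ps_partial c p s x t K) (F x t).

(* phi : [0,1]^m x [0,1] -> R^d is (real) analytic, i.e. analytic on a
   neighbourhood of the closed domain: every component is analytic at
   every point of [0,1]^m x [0,1]. *)
Definition family_analytic (m d : nat)
  (phi : ('I_m -> R) -> R -> ('I_d -> R)) : Prop :=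
  forall (i : 'I_d) (p : 'I_m -> R) (s : R),
    in_cube p -> 0 <= s <= 1 -> analytic_at (fun x t => phi x t i) p s.

(* N u {oo}: None stands for infinity. *)
Definition enat := option nat.
Definition enat_le (a b : enat) : Prop :=
  match a, b with
  | _, None => True
  | None, Some _ => False
  | Some x, Some y => (x <= y)%nat
  end.

Definition hdot_deriv (d : nat) (g : R -> 'I_d -> R) (h : 'I_d -> Z)
  (j : nat) (t : R) : R :=
  rsum (fun i : 'I_d => IZR (h i) * Derive_n (fun u => g u i) j t).

Definition rnd_index (d : nat) (g : R -> 'I_d -> R) (j : nat) : Prop :=
  (1 <= j)%nat /\
  forall h : 'I_d -> Z, (exists i, h i <> Z0) ->
    exists t, 0 <= t <= 1 /\ hdot_deriv g h j t <> 0.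

Definition curve_rnd_order (d : nat) (g : R -> 'I_d -> R) (k : enat) : Prop :=
  (forall j, rnd_index g j -> enat_le (Some j) k) /\
  (forall u : enat, (forall j, rnd_index g j -> enat_le (Some j) u) ->
     enat_le k u).

Definition family_rnd_order (m d : nat)
  (phi : ('I_m -> R) -> R -> ('I_d -> R)) (k : enat) : Prop :=
  exists ord : ('I_m -> R) -> enat,
    (forall x, in_cube x -> curve_rnd_order (phi x) (ord x)) /\
    (forall x, in_cube x -> enat_le k (ord x)) /\
    (forall u : enat, (forall x, in_cube x -> enat_le u (ord x)) ->
       enat_le u k).

(* Continuous functions on T^d = R^d / Z^d, represented as continuous
   Z^d-periodic functions on R^d. *)
Definition vec_continuous (d : nat) (f : ('I_d -> R) -> R) : Prop :=
  forall (v : 'I_d -> R) (eps : R), 0 < eps ->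
    exists delta, 0 < delta /\
      forall w : 'I_d -> R, (forall i, Rabs (w i - v i) < delta) ->
        Rabs (f w - f v) < eps.

Definition Zd_periodic (d : nat) (f : ('I_d -> R) -> R) : Prop :=
  forall (v : 'I_d -> R) (z : 'I_d -> Z), f (fun i => v i + IZR (z i)) = f v.

Definition torus_continuous (d : nat) (f : ('I_d -> R) -> R) : Prop :=
  vec_continuous f /\ Zd_periodic f.

(* Integral against normalized Haar measure on T^d, for continuous f:
   the (iterated Riemann) integral of the periodic lift over [0,1]^d. *)
Fixpoint iter_int (n : nat) (g : (nat -> R) -> R) : R :=
  match n with
  | O => g (fun _ => 0)
  | S n' => RInt (fun s => iter_int n'
               (fun v => g (fun k => if Nat.eqb k n' then s else v k))) 0 1
  end.

Definition haar_int (d : nat) (f : ('I_d -> R) -> R) : R :=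
  iter_int d (fun v => f (fun i : 'I_d => v (nat_of_ord i))).

(* Main.v *)
(** By Weyl's criterion the theorem reduces to exponential sums with phase
    [rho n * F (x, k / n)], where [F = <h, phi>] and the [q]-th [t]-derivative
    of [F x] is not identically zero for any [x], with [rho n = o(n^q)].

    By analyticity that derivative has isolated zeros on [[0, 1]]; away from
    them it is bounded below, uniformly for [x] in a neighbourhood of a given
    parameter, and compactness of the cube makes everything uniform in [x].
    On such pieces the phase [f k] has [q]-th differences comparable to
    [lam = rho n / n^q].  Van der Corput's inequality with shifts by multiples
    of a suitably chosen step turns this into the same problem of order
    [q - 1], and order [1] is the Kusmin-Landau inequality.

    The integral over the torus is reached one coordinate at a time, with
    Fejer's kernel and the test functions [1 - cos] of Korovkin's theorem. *)

Require Import Defs.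
From Stdlib Require Import Reals ZArith Lra Lia.
From Stdlib Require Import Classical ClassicalEpsilon FunctionalExtensionality.
From Coquelicot Require Import Coquelicot.
From mathcomp Require Import all_boot all_algebra Rstruct zify.

Set Implicit Arguments.
Unset Strict Implicit.
Unset Printing Implicit Defensive.

Import Num.Theory.

Local Open Scope R_scope.

Local Notation "\rsum_ ( k < n ) F" := (rsum (fun k : 'I_n => F))
  (at level 35, F at level 40, k, n at level 50,
   format "'[' \rsum_ ( k  <  n ) '/  '  F ']'").

(** * Finite sums *)

Lemma leq_INR m n : (m <= n)%N -> INR m <= INR n.
Proof. by move=> le_mn; apply: le_INR; lia. Qed.

Lemma INR_gt0 n : (0 < n)%N -> 0 < INR n.
Proof. by move=> n_gt0; apply: lt_0_INR; lia. Qed.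

Lemma INR_leq m n : INR m <= INR n -> (m <= n)%N.
Proof. by move=> /INR_le; lia. Qed.

Lemma exists_INR_ge x : exists n : nat, (0 < n)%N /\ x <= INR n.
Proof.
have [n xn] := INR_archimed 1 x Rlt_0_1.
by exists n.+1; split => //; rewrite S_INR; lra.
Qed.

Lemma Rabs_mult_le x y c : Rabs x <= 1 -> Rabs y <= c -> Rabs (x * y) <= c.
Proof.
by move=> x_le1 y_le; rewrite Rabs_mult; have := Rabs_pos x; have := Rabs_pos y; nra.
Qed.

Section FiniteSums.
Context {I : finType}.
Implicit Types F G : I -> R.

Lemma rsum_ext F G : (forall i, F i = G i) -> rsum F = rsum G.
Proof. by move=> eqFG; apply: eq_bigr => i _. Qed.

Lemma rsum_plus F G : rsum (fun i => F i + G i) = rsum F + rsum G.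
Proof. by rewrite /rsum RplusE big_split. Qed.

Lemma rsum_minus F G : rsum (fun i => F i - G i) = rsum F - rsum G.
Proof. by rewrite /rsum RminusE -GRing.sumrB; apply: eq_bigr => i _; rewrite RminusE. Qed.

Lemma rsum_scal_l c F : rsum (fun i => c * F i) = c * rsum F.
Proof. by rewrite /rsum RmultE big_distrr. Qed.

Lemma rsum_le F G : (forall i, F i <= G i) -> rsum F <= rsum G.
Proof. by move=> leFG; apply/RleP; apply: ler_sum => i _; apply/RleP. Qed.

Lemma rsum_ge0 F : (forall i, 0 <= F i) -> 0 <= rsum F.
Proof. by move=> F_ge0; apply/RleP; apply: sumr_ge0 => i _; apply/RleP. Qed.

Lemma rsum_ge_term F i : (forall i, 0 <= F i) -> F i <= rsum F.
Proof.
move=> F_ge0; apply/RleP; rewrite /rsum (bigD1 i) //= lerDl.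
by apply: sumr_ge0 => j _; apply/RleP.
Qed.

Lemma Rabs_rsum_le F : Rabs (rsum F) <= rsum (fun i => Rabs (F i)).
Proof.
by apply/RleP; rewrite RabsE; apply: (ler_norm_sum _ F).
Qed.

Lemma rsum_delta i c : rsum (fun j : I => if i == j then c else 0) = c.
Proof.
rewrite /rsum -big_mkcond /= (big_pred1 i) // => j; exact: eq_sym.
Qed.

Lemma rsum_inj_le (J : finType) (h : I -> J) (G : J -> R) :
  injective h -> (forall j, 0 <= G j) -> rsum (fun i => G (h i)) <= rsum G.
Proof.
move=> inj_h G_ge0; apply/RleP.
rewrite /rsum [X in (_ <= X)%R](bigID (mem [set h i | i in I])) /=.
rewrite big_imset /=; last by move=> x y _ _; apply: inj_h.
rewrite (eq_bigl predT) // lerDl.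
by apply: sumr_ge0 => j _; apply/RleP.
Qed.

Lemma is_lim_seq_rsum (u : nat -> I -> R) (l : I -> R) :
  (forall i, is_lim_seq (fun n => u n i) (l i)) ->
  is_lim_seq (fun n => rsum (u n)) (rsum l).
Proof.
rewrite /rsum => lim_u; elim: (index_enum I) => [|i r IHr].
  apply: (is_lim_seq_ext (fun=> 0)) => [n|]; rewrite big_nil //.
  exact: is_lim_seq_const.
apply: (is_lim_seq_ext (fun n => u n i + (\sum_(j <- r) u n j)%R)) => [n|].
  by rewrite big_cons.
by rewrite big_cons; apply: is_lim_seq_plus'.
Qed.

Lemma cos_sum_sqr (a : I -> R) :
  rsum (fun i => rsum (fun j => cos (a i - a j))) =
  rsum (fun i => cos (a i)) ^ 2 + rsum (fun i => sin (a i)) ^ 2.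
Proof.
set C := rsum (fun i => cos _); set S := rsum (fun i => sin _).
transitivity (rsum (fun i => C * cos (a i) + S * sin (a i))).
  apply: rsum_ext => i.
  rewrite (rsum_ext (G := fun j => cos (a i) * cos (a j) + sin (a i) * sin (a j))).
    by rewrite rsum_plus !rsum_scal_l -/C -/S; ring.
  by move=> j; rewrite cos_minus.
by rewrite rsum_plus !rsum_scal_l -/C -/S; ring.
Qed.
End FiniteSums.

Lemma rsum_exchange (I J : finType) (F : I -> J -> R) :
  rsum (fun i => rsum (fun j => F i j)) = rsum (fun j => rsum (fun i => F i j)).
Proof. exact: exchange_big. Qed.

Lemma rsum_const n c : \rsum_(k < n) c = INR n * c.
Proof. by rewrite /rsum GRing.sumr_const card_ord -GRing.mulr_natl INRE. Qed.

Lemma rsum_ord0 (f : 'I_0 -> R) : rsum f = 0.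
Proof. exact: big_ord0. Qed.

Lemma rsum_recr n (f : nat -> R) : \rsum_(k < n.+1) f k = \rsum_(k < n) f k + f n.
Proof. by rewrite /rsum big_ord_recr. Qed.

Lemma rsum_cat n m (f : nat -> R) :
  \rsum_(k < n + m) f k = \rsum_(k < n) f k + \rsum_(k < m) f (n + k)%N.
Proof. by rewrite /rsum big_split_ord. Qed.

Lemma rsum_telescope n (f : nat -> R) : \rsum_(k < n) (f k.+1 - f k) = f n - f O.
Proof.
elim: n => [|n IHn]; first by rewrite Rminus_diag rsum_ord0.
by rewrite (rsum_recr _ (fun k => f k.+1 - f k)) IHn; ring.
Qed.

Lemma Rabs_rsum_le_const n (f : 'I_n -> R) c :
  (forall k, Rabs (f k) <= c) -> Rabs (rsum f) <= INR n * c.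
Proof.
move=> f_le; rewrite -rsum_const.
exact: Rle_trans (Rabs_rsum_le _) (rsum_le f_le).
Qed.

Lemma sqr_rsum_le n (f : 'I_n -> R) : rsum f ^ 2 <= INR n * rsum (fun k => f k ^ 2).
Proof.
suff : 0 <= 2 * (INR n * rsum (fun k => f k ^ 2) - rsum f ^ 2) by lra.
have -> : 2 * (INR n * rsum (fun k => f k ^ 2) - rsum f ^ 2) =
    rsum (fun i => rsum (fun j => (f i - f j) ^ 2)).
  rewrite [RHS](rsum_ext (G := fun i =>
    INR n * f i ^ 2 + (rsum (fun k => f k ^ 2) - 2 * rsum f * f i))).
    by rewrite rsum_plus rsum_minus !rsum_scal_l rsum_const; ring.
  move=> i; rewrite [LHS](rsum_ext (G := fun j => f i ^ 2 + (f j ^ 2 - 2 * f i * f j))).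
    by rewrite rsum_plus rsum_minus !rsum_scal_l rsum_const; ring.
  by move=> j; ring.
by do 2 (apply: rsum_ge0 => ?); apply: pow2_ge_0.
Qed.

Lemma rsum_shift_dist n h (f : nat -> R) c :
  (forall k, Rabs (f k) <= c) ->
  Rabs (\rsum_(k < n) f (h + k)%N - \rsum_(k < n) f k) <= 2 * (INR h * c).
Proof.
move=> f_le.
have -> : \rsum_(k < n) f (h + k)%N - \rsum_(k < n) f k =
    \rsum_(k < h) f (n + k)%N - \rsum_(k < h) f k.
  by have := rsum_cat n h f; rewrite addnC rsum_cat; lra.
have tail_le : Rabs (\rsum_(k < h) f (n + k)%N) <= INR h * c by exact: Rabs_rsum_le_const.
have head_le : Rabs (\rsum_(k < h) f k) <= INR h * c by exact: Rabs_rsum_le_const.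
by move: tail_le head_le; clear; split_Rabs; lra.
Qed.

Lemma rsum_trunc_dist n h (f : nat -> R) c :
  (forall k, Rabs (f k) <= c) ->
  Rabs (\rsum_(k < n) f k - \rsum_(k < n - h) f k) <= INR h * c.
Proof.
move=> f_le; have [le_hn|lt_nh] := leqP h n.
  have := rsum_cat (n - h) h f; rewrite subnK // => ->.
  by rewrite Rplus_minus_l; apply: Rabs_rsum_le_const.
have -> : (n - h = 0)%N by lia.
rewrite [X in _ - X]rsum_ord0 Rminus_0_r.
apply: (Rle_trans _ (INR n * c)); first exact: Rabs_rsum_le_const.
apply: Rmult_le_compat_r; last exact/leq_INR/ltnW.
by apply: Rle_trans (f_le O); apply: Rabs_pos.
Qed.

(** * Van der Corput's method for finite differences *)

Lemma Rabs_cos_le1 x : Rabs (cos x) <= 1.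
Proof. exact/Rabs_le/COS_bound. Qed.

Lemma Rabs_sin_le1 x : Rabs (sin x) <= 1.
Proof. exact/Rabs_le/SIN_bound. Qed.

Lemma sin_ge_half x : 0 <= x <= 1 -> x / 2 <= sin x.
Proof.
move=> x01; have [||sin_ge _] := pre_sin_bound x 0; try lra.
by move: sin_ge; rewrite /sin_approx /sum_f_R0 /sin_term /=; nra.
Qed.

Lemma cot_bound a x : 0 < a <= x -> x <= 1 -> Rabs (cos x / sin x) <= 2 / a.
Proof.
move=> ax x1; have sin_ge : a / 2 <= sin x by have := @sin_ge_half x; lra.
have inv_sin_le : / sin x <= / (a / 2) by apply: Rinv_le_contravar; lra.
have inv_sin_gt0 : 0 < / sin x by apply: Rinv_0_lt_compat; lra.
rewrite /Rdiv Rabs_mult (Rabs_right (/ sin x)); last lra.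
have -> : 2 * / a = 1 * / (a / 2) by field; lra.
apply: Rmult_le_compat => //; [exact: Rabs_pos | lra | exact: Rabs_cos_le1].
Qed.

Lemma cot_lipschitz a x y : 0 < a <= x -> a <= y -> x <= 1 -> y <= 1 ->
  Rabs (cos x / sin x - cos y / sin y) <= 4 / a ^ 2 * Rabs (x - y).
Proof.
move=> ax ay x1 y1.
have sin_ge t : Rmin y x <= t <= Rmax y x -> a / 2 <= sin t.
  move=> t_btw; have := @sin_ge_half t; suff : a <= t <= 1 by lra.
  by move: t_btw; rewrite /Rmin /Rmax; case: Rle_dec; lra.
have cot' t : 0 < sin t -> is_derive (fun t => cos t / sin t) t (- / sin t ^ 2).
  move=> sin_gt0; auto_derive; first lra.
  by have := sin2_cos2 t; rewrite /Rsqr => sc; field_simplify_eq; lra.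
have [||c [c_btw ->]] := MVT_gen (fun t => cos t / sin t) y x (fun t => - / sin t ^ 2).
- by move=> t t_btw; apply: cot'; have := sin_ge t; lra.
- move=> t t_btw; apply/continuity_pt_filterlim.
  apply: (ex_derive_continuous (fun t => cos t / sin t)).
  by eexists; apply: cot'; have := sin_ge t; lra.
have inv_le : / sin c ^ 2 <= / (a / 2) ^ 2.
  by apply: Rinv_le_contravar; have := sin_ge c c_btw; nra.
rewrite Rabs_mult Rabs_Ropp Rabs_right.
  apply: Rmult_le_compat_r (Rabs_pos _) _.
  by have -> : 4 / a ^ 2 = / (a / 2) ^ 2 by field; lra.
by apply/Rle_ge/Rlt_le/Rinv_0_lt_compat; have := sin_ge c c_btw; nra.
Qed.

Fixpoint fdiff (j : nat) (f : nat -> R) (k : nat) : R :=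
  match j with
  | O => f k
  | S i => fdiff i (fun l => f l.+1 - f l) k
  end.

Lemma fdiff_ext j f g k : (forall i, f i = g i) -> fdiff j f k = fdiff j g k.
Proof. by move=> /(functional_extensionality f g) ->. Qed.

Lemma fdiff_plus j f g k : fdiff j (fun i => f i + g i) k = fdiff j f k + fdiff j g k.
Proof.
by elim: j f g => [//|j IHj] f g /=; rewrite -IHj; apply: fdiff_ext => i; ring.
Qed.

Lemma fdiff_scal_l j c f k : fdiff j (fun i => c * f i) k = c * fdiff j f k.
Proof.
by elim: j f => [//|j IHj] f /=; rewrite -IHj; apply: fdiff_ext => i; ring.
Qed.

Lemma fdiff_const j c k : fdiff j.+1 (fun=> c) k = 0.
Proof.
rewrite /= -[RHS](Rmult_0_l (fdiff j (fun=> c) k)) -fdiff_scal_l.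
by apply: fdiff_ext => i; ring.
Qed.

Lemma fdiff_shift j f h k : fdiff j (fun i => f (i + h)%N) k = fdiff j f (k + h)%N.
Proof. by elim: j f => [//|j IHj] f /=; rewrite -IHj. Qed.

Lemma fdiff_increment j f h k :
  fdiff j (fun i => f (i + h)%N - f i) k = \rsum_(i < h) fdiff j.+1 f (k + i)%N.
Proof.
rewrite (rsum_ext (G := fun i : 'I_h => fdiff j (fun l => f (l + i).+1 - f (l + i)%N) k)).
  elim: h => [|h IHh].
    rewrite rsum_ord0 -[RHS](Rmult_0_l (fdiff j f k)) -fdiff_scal_l.
    by apply: fdiff_ext => i; rewrite addn0; ring.
  rewrite (rsum_recr _ (fun i => fdiff j (fun l => f (l + i).+1 - f (l + i)%N) k)).
  by rewrite -IHh -fdiff_plus; apply: fdiff_ext => i; rewrite addnS; ring.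
by move=> i; rewrite /= -fdiff_shift.
Qed.

Lemma summation_by_parts n (s c : nat -> R) :
  \rsum_(k < n.+1) ((s k.+1 - s k) * c k) =
  s n.+1 * c n - s O * c O - \rsum_(k < n) (s k.+1 * (c k.+1 - c k)).
Proof.
rewrite (rsum_recr n (fun k => (s k.+1 - s k) * c k)).
have := rsum_telescope n (fun k => s k * c k).
have -> : \rsum_(k < n) (s k.+1 * c k.+1 - s k * c k) =
    \rsum_(k < n) ((s k.+1 - s k) * c k) + \rsum_(k < n) (s k.+1 * (c k.+1 - c k)).
  by rewrite -rsum_plus; apply: rsum_ext => k; ring.
by lra.
Qed.

Lemma abel_bound n (s c : nat -> R) C D :
  (forall k, Rabs (s k) <= 1) ->
  (forall k, (k <= n)%N -> Rabs (c k) <= C) ->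
  (forall k, (k < n)%N -> Rabs (c k.+1 - c k) <= D) ->
  Rabs (\rsum_(k < n.+1) ((s k.+1 - s k) * c k)) <= 2 * C + INR n * D.
Proof.
move=> s_le1 c_le dc_le.
have last_le := Rabs_mult_le (s_le1 n.+1) (c_le n (leqnn n)).
have head_le := Rabs_mult_le (s_le1 O) (c_le O (leq0n n)).
have inner_le : Rabs (\rsum_(k < n) (s k.+1 * (c k.+1 - c k))) <= INR n * D.
  by apply: Rabs_rsum_le_const => k; apply: Rabs_mult_le; [exact: s_le1 | exact: dc_le].
by rewrite summation_by_parts; move: last_le head_le inner_le; split_Rabs; lra.
Qed.

(* [cos (f k)] is [cot (theta / 2) / 2] times the increment of [sin \o f], up to
   half the increment of [cos \o f], where [theta] is the increment of [f]. *)
Lemma kusmin_landau n (f : nat -> R) a D : 0 < a ->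
  (forall k, (k <= n)%N -> a <= fdiff 1 f k <= 2) ->
  (forall k, (k < n)%N -> Rabs (fdiff 2 f k) <= D) ->
  Rabs (\rsum_(k < n.+1) cos (f k)) <= 4 / a + 4 / a ^ 2 * (INR n * D) + 1.
Proof.
move=> a_gt0 df_btw d2f_le.
pose theta k := (f k.+1 - f k) / 2; pose cot k := cos (theta k) / sin (theta k).
have theta_btw k : (k <= n)%N -> 0 < a / 2 <= theta k /\ theta k <= 1.
  by move=> /df_btw; rewrite /theta /=; lra.
have cos_sumE : \rsum_(k < n.+1) cos (f k) =
    / 2 * \rsum_(k < n.+1) ((sin (f k.+1) - sin (f k)) * cot k)
    - / 2 * (cos (f n.+1) - cos (f O)).
  rewrite -(rsum_telescope n.+1 (fun k => cos (f k))) -!rsum_scal_l -rsum_minus.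
  apply: rsum_ext => k; have [] := theta_btw k (ltn_ord k) => theta_ge theta_le.
  have sin_gt0 : 0 < sin (theta k) by have := @sin_ge_half (theta k); lra.
  have -> : f k.+1 = f k + 2 * theta k by rewrite /theta; field.
  rewrite sin_plus cos_plus sin_2a cos_2a /cot.
  have cos_sqr : cos (theta k) ^ 2 = 1 - sin (theta k) ^ 2.
    by have := sin2_cos2 (theta k); rewrite /Rsqr; lra.
  by field_simplify_eq; [ring [cos_sqr] | lra].
have cot_sum_le : Rabs (\rsum_(k < n.+1) ((sin (f k.+1) - sin (f k)) * cot k)) <=
    2 * (2 / (a / 2)) + INR n * (4 / (a / 2) ^ 2 * (D / 2)).
  apply: (abel_bound (s := fun k => sin (f k))) => [k|k le_kn|k lt_kn].
  - exact: Rabs_sin_le1.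
  - by have [] := theta_btw k le_kn; apply: cot_bound.
  - have [ge0 le0] := theta_btw k (ltnW lt_kn); have [ge1 le1] := theta_btw k.+1 lt_kn.
    apply: Rle_trans (cot_lipschitz ge1 (proj2 ge0) le1 le0) _.
    apply: Rmult_le_compat_l; first by apply: Rdiv_le_0_compat; nra.
    have -> : theta k.+1 - theta k = / 2 * fdiff 2 f k by rewrite /theta /=; field.
    by rewrite Rabs_mult Rabs_right; have := d2f_le k lt_kn; lra.
have -> : 4 / a + 4 / a ^ 2 * (INR n * D) + 1 =
    / 2 * (2 * (2 / (a / 2)) + INR n * (4 / (a / 2) ^ 2 * (D / 2))) + 1 by field; lra.
have := COS_bound (f n.+1); have := COS_bound (f O).
by move: cot_sum_le; rewrite cos_sumE; split_Rabs; lra.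
Qed.

Section VanDerCorput.
Variables (f : nat -> R) (N L q : nat).
Hypothesis L_gt0 : (0 < L)%N.

Let shifted_sum := \rsum_(k < N) \rsum_(i < L) cos (f (i * q + k)%N).
Let correlation i j := \rsum_(k < N) cos (f (i * q + k)%N - f (j * q + k)%N).

Lemma shifted_sum_dist :
  Rabs (shifted_sum - INR L * \rsum_(k < N) cos (f k)) <= INR L * (2 * (INR L * INR q)).
Proof.
rewrite /shifted_sum rsum_exchange -(rsum_const L) -rsum_minus.
apply: Rabs_rsum_le_const => i.
apply: Rle_trans (rsum_shift_dist N (i * q) (fun k => Rabs_cos_le1 (f k))) _.
rewrite Rmult_1_r -mult_INR; apply: Rmult_le_compat_l; first lra.
by apply: leq_INR; have := ltn_ord i; nia.
Qed.

Lemma shifted_sum_sqr_le :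
  shifted_sum ^ 2 <= INR N * \rsum_(i < L) \rsum_(j < L) correlation i j.
Proof.
apply: Rle_trans (sqr_rsum_le _) _; apply: Rmult_le_compat_l; first exact: pos_INR.
have -> : \rsum_(i < L) \rsum_(j < L) correlation i j =
    \rsum_(k < N) \rsum_(i < L) \rsum_(j < L) cos (f (i * q + k)%N - f (j * q + k)%N).
  by rewrite [RHS]rsum_exchange; apply: rsum_ext => i; rewrite [RHS]rsum_exchange.
apply: rsum_le => k; rewrite (cos_sum_sqr (fun i : 'I_L => f (i * q + k)%N)).
by rewrite -[X in X <= _]Rplus_0_r; apply/Rplus_le_compat_l/pow2_ge_0.
Qed.

Variable Y : R.
Hypothesis diff_sum_le : forall p, (0 < p < L)%N ->
  Rabs (\rsum_(k < N - p * q) cos (f (k + p * q)%N - f k)) <= Y.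

Lemma correlation_le i j : (i < L)%N -> (j < L)%N -> i != j ->
  correlation i j <= Y + 3 * (INR L * INR q).
Proof.
wlog lt_ji : i j / (j < i)%N => [gt_case|] lt_iL lt_jL ne_ij.
  case: (ltnP j i) => [/gt_case|le_ij]; first exact.
  have -> : correlation i j = correlation j i.
    by apply: rsum_ext => k; rewrite -cos_neg; congr cos; ring.
  by apply: gt_case; rewrite 1?eq_sym // ltn_neqAle ne_ij.
pose v k := cos (f (k + (i - j) * q)%N - f k).
have v_le1 k : Rabs (v k) <= 1 by exact: Rabs_cos_le1.
have -> : correlation i j = \rsum_(k < N) v (j * q + k)%N.
  by apply: rsum_ext => k; rewrite /v; congr (cos (f _ - _)); nia.
have shift_le := rsum_shift_dist N (j * q) v_le1.
have trunc_le := rsum_trunc_dist N ((i - j) * q) v_le1.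
have diff_le : Rabs (\rsum_(k < N - (i - j) * q) v k) <= Y by apply: diff_sum_le; lia.
have jq_le : INR (j * q) <= INR L * INR q by rewrite -mult_INR; apply: leq_INR; nia.
have ijq_le : INR ((i - j) * q) <= INR L * INR q.
  by rewrite -mult_INR; apply: leq_INR; nia.
by move: shift_le trunc_le diff_le; split_Rabs; lra.
Qed.

Lemma correlation_sum_le : 0 <= Y ->
  \rsum_(i < L) \rsum_(j < L) correlation i j <=
  INR L * (INR N + INR L * (Y + 3 * (INR L * INR q))).
Proof.
move=> Y_ge0; set c := Y + _; have c_ge0 : 0 <= c.
  by have := pos_INR L; have := pos_INR q; rewrite /c; nra.
rewrite -rsum_const; apply: rsum_le => i.
have -> : INR N + INR L * c = \rsum_(j < L) ((if i == j then INR N else 0) + c).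
  by rewrite rsum_plus rsum_const (rsum_delta i).
apply: rsum_le => j; case: eqP => [<-|/eqP ne_ij]; last first.
  by rewrite Rplus_0_l; apply: correlation_le.
suff -> : correlation i i = INR N by lra.
rewrite -[INR N]Rmult_1_r -rsum_const; apply: rsum_ext => k.
by rewrite Rminus_diag cos_0.
Qed.

Lemma van_der_corput : 0 <= Y ->
  Rabs (\rsum_(k < N) cos (f k)) <=
  2 * (INR L * INR q) + sqrt (INR N * (INR N / INR L + Y + 3 * (INR L * INR q))).
Proof.
move=> Y_ge0; have LR_gt0 := INR_gt0 L_gt0.
set Q := INR N * _; suff W_le : Rabs shifted_sum <= INR L * sqrt Q.
  apply: (Rmult_le_reg_l (INR L)) => //.
  rewrite -{1}(Rabs_right (INR L)) -?Rabs_mult; last lra.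
  by move: W_le shifted_sum_dist; split_Rabs; lra.
have -> : INR L * sqrt Q = sqrt (INR L ^ 2 * Q).
  by rewrite sqrt_mult_alt ?sqrt_pow2 //; [lra | apply: pow2_ge_0].
rewrite -sqrt_Rsqr_abs; apply: sqrt_le_1_alt; rewrite Rsqr_pow2.
apply: Rle_trans shifted_sum_sqr_le _.
have -> : INR L ^ 2 * Q =
    INR N * (INR L * (INR N + INR L * (Y + 3 * (INR L * INR q)))).
  by rewrite /Q; field; lra.
by apply: Rmult_le_compat_l (correlation_sum_le Y_ge0); apply: pos_INR.
Qed.
End VanDerCorput.

Definition regular_phase (j n N : nat) (delta M lam : R) (f : nat -> R) : Prop :=
  (forall k, (k < N)%N -> delta * lam <= fdiff j f k <= M * lam) /\
  (forall k, (k < N)%N -> Rabs (fdiff j.+1 f k) <= M * lam / INR n).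

Lemma regular_phase_increment j n N h delta M lam f : (0 < n)%N ->
  regular_phase j.+1 n N delta M lam f ->
  regular_phase j n (N - h) delta M (lam * INR h) (fun k => f (k + h)%N - f k).
Proof.
move=> n_gt0 [df_btw ddf_le]; split=> k lt_k; rewrite fdiff_increment.
  rewrite (_ : delta * _ = \rsum_(i < h) (delta * lam)); last by rewrite rsum_const; ring.
  rewrite (_ : M * _ = \rsum_(i < h) (M * lam)); last by rewrite rsum_const; ring.
  have le_kiN (i : 'I_h) : (k + i < N)%N by have := ltn_ord i; lia.
  by split; apply: rsum_le => i; have [] := df_btw _ (le_kiN i).
have -> : M * (lam * INR h) / INR n = INR h * (M * lam / INR n).
  by field; have := INR_gt0 n_gt0; lra.
by apply: Rabs_rsum_le_const => i; apply: ddf_le; have := ltn_ord i; lia.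
Qed.

Definition cos_sums_small (j : nat) : Prop :=
  forall delta M eps, 0 < delta -> 0 < M -> 0 < eps ->
  exists lo eta, 0 < lo /\ 0 < eta /\
  forall (n N : nat) (f : nat -> R) (lam : R),
    (0 < n)%N -> (N <= n)%N -> 0 < lam <= eta -> lo <= lam * INR n ^ j ->
    regular_phase j n N delta M lam f ->
    Rabs (\rsum_(k < N) cos (f k)) <= eps * INR n.

Lemma cos_sums_small1 : cos_sums_small 1.
Proof.
move=> delta M eps delta_gt0 M_gt0 eps_gt0.
pose K := 4 / delta + 4 * M / delta ^ 2 + 1.
have K_gt0 : 0 < K.
  have : 0 < 4 / delta by apply: Rdiv_lt_0_compat; lra.
  have : 0 < 4 * M / delta ^ 2 by apply: Rdiv_lt_0_compat; nra.
  by rewrite /K; lra.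
exists (K / eps), (Rmin 1 (1 / M)); split; first exact: Rdiv_lt_0_compat.
split; first by apply: Rmin_glb_lt; [lra | apply: Rdiv_lt_0_compat; lra].
move=> n N f lam n_gt0 le_Nn lam_btw; rewrite pow_1 => n_large [df_btw ddf_le].
have nR_gt0 := INR_gt0 n_gt0.
have lam_le1 : lam <= 1 by have := Rmin_l 1 (1 / M); lra.
have Mlam_le1 : lam * M <= 1 by apply/(Rle_div_r _ _ _ M_gt0); have := Rmin_r 1 (1 / M); lra.
case: N le_Nn df_btw ddf_le => [|N] le_Nn df_btw ddf_le.
  by rewrite rsum_ord0 Rabs_R0; nra.
have NMn : INR N * (M * lam / INR n) <= M * lam.
  have -> : INR N * (M * lam / INR n) = M * lam * (INR N / INR n) by field; lra.
  rewrite -[X in _ <= X]Rmult_1_r; apply: Rmult_le_compat_l; first by nra.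
  by apply/(Rdiv_le_1 _ _ nR_gt0)/leq_INR; lia.
apply: (Rle_trans _ (K / lam)); last first.
  apply/Rle_div_l; first lra.
  by move: n_large => /(Rle_div_l _ _ _ eps_gt0); lra.
apply: Rle_trans (kusmin_landau (a := delta * lam) (D := M * lam / INR n) _ _ _) _.
- by nra.
- by move=> k le_kN; have := df_btw k le_kN; lra.
- by move=> k lt_kN; apply: ddf_le; lia.
have -> : K / lam = 4 / (delta * lam) + 4 / (delta * lam) ^ 2 * (M * lam) + / lam.
  by rewrite /K; field; lra.
apply: Rplus_le_compat; last by rewrite -Rinv_1; apply: Rinv_le_contravar; lra.
apply: Rplus_le_compat_l; apply: Rmult_le_compat_l NMn.
by apply: Rdiv_le_0_compat; [lra | apply: pow_lt; nra].
Qed.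

(* The step is [q = 1 + floor (lo / (lam n^j))]: its multiples [p q], [p < L], make
   the phase increments oscillate, yet keep the shifts and the new [lam] small. *)
Lemma exists_shift_step j L lo e eta : (0 < j)%N -> 0 < L -> 0 < lo -> 0 < e -> 0 < eta ->
  exists lo' eta', 0 < lo' /\ 0 < eta' /\
  forall n lam, (0 < n)%N -> 0 < lam <= eta' -> lo' <= lam * INR n ^ j.+1 ->
  exists q, [/\ (0 < q)%N, lo <= lam * INR q * INR n ^ j,
    L * INR q <= e * INR n & lam * (L * INR q) <= eta].
Proof.
move=> j_gt0 L_gt0 lo_gt0 e_gt0 eta_gt0.
pose X := Rmax (2 * L * lo / eta) (2 * L / e).
have X_gt0 : 0 < X by apply: Rlt_le_trans (Rmax_r _ _); apply: Rdiv_lt_0_compat; lra.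
exists (Rmax (2 * L * lo / e) (X ^ j.+1 + 1)), (Rmin 1 (eta / (2 * L))).
split; first by apply: Rlt_le_trans (Rmax_r _ _); have := pow_lt X j.+1 X_gt0; lra.
split; first by apply: Rmin_glb_lt; [lra | apply: Rdiv_lt_0_compat; lra].
move=> n lam n_gt0 [lam_gt0 lam_le] n_large; have nR_gt0 := INR_gt0 n_gt0.
have lam_le1 : lam <= 1 by apply: Rle_trans lam_le (Rmin_l _ _).
have lam_le_eta : lam * (2 * L) <= eta.
  by apply/Rle_div_r; [lra | apply: Rle_trans lam_le (Rmin_r _ _)].
have X_le : X <= INR n.
  apply: Rnot_lt_le => lt_nX.
  have : INR n ^ j.+1 <= X ^ j.+1 by apply: pow_incr; lra.
  by have := Rle_trans _ _ _ (Rmax_r _ _) n_large; have := pow_lt _ j.+1 nR_gt0; nra.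
have n_ge_eta : 2 * L * lo <= INR n * eta.
  by apply/(Rle_div_l _ _ _ eta_gt0)/(Rle_trans _ _ _ _ X_le)/Rmax_l.
have n_ge_e : 2 * L <= INR n * e.
  by apply/(Rle_div_l _ _ _ e_gt0)/(Rle_trans _ _ _ _ X_le)/Rmax_r.
have lamn_ge : 2 * L * lo <= lam * INR n ^ j.+1 * e.
  by apply/(Rle_div_l _ _ _ e_gt0)/(Rle_trans _ _ _ _ n_large)/Rmax_l.
have nj_gt0 : 0 < INR n ^ j by apply: pow_lt.
have n_le_nj : INR n <= INR n ^ j.
  by rewrite -{1}(pow_1 (INR n)); apply: Rle_pow; [apply: (leq_INR n_gt0) | lia].
pose P := lam * INR n ^ j; have P_gt0 : 0 < P by apply: Rmult_lt_0_compat.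
have [p [p_le lt_p]] := nfloor_ex (lo / P) ltac:(apply: Rdiv_le_0_compat; lra).
have P_le : INR p * P <= lo by apply/Rle_div_r.
have lt_P : lo < (INR p + 1) * P by apply/Rlt_div_l.
exists p.+1; rewrite S_INR; split; first by [].
- by move: lt_P; rewrite /P; lra.
- apply: (Rmult_le_reg_r P) => //.
  have -> : L * (INR p + 1) * P = L * (INR p * P + P) by ring.
  rewrite (_ : lam * _ = INR n * P) in lamn_ge; last by rewrite /P /=; ring.
  by nra.
- apply: (Rmult_le_reg_r (INR n ^ j)) => //.
  have -> : lam * (L * (INR p + 1)) * INR n ^ j = L * (INR p * P + P) by rewrite /P; ring.
  have : 2 * (L * P) <= eta * INR n ^ j by rewrite /P; nra.
  by nra.
Qed.

(* Weyl differencing lowers the order by one; shifting by the multiples of one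
   step [q] only, a bounded number [L] of times, keeps all the differences in the
   range of the lower order case. *)
Lemma cos_sums_smallS j : (0 < j)%N -> cos_sums_small j -> cos_sums_small j.+1.
Proof.
move=> j_gt0 small_j delta M eps delta_gt0 M_gt0 eps_gt0.
pose e := Rmin eps 1; have e_gt0 : 0 < e by apply: Rmin_glb_lt; lra.
have [e_le1 e_le_eps] : e <= 1 /\ e <= eps by split; [apply: Rmin_r | apply: Rmin_l].
have e2_gt0 : 0 < e ^ 2 by apply: pow_lt.
have [L [L_gt0 L_ge]] := exists_INR_ge (16 / e ^ 2); have LR_gt0 := INR_gt0 L_gt0.
have [lo [eta [lo_gt0 [eta_gt0 small_diff]]]] :=
  small_j delta M (e ^ 2 / 16) delta_gt0 M_gt0 ltac:(lra).
have [lo' [eta' [lo'_gt0 [eta'_gt0 shift_step]]]] :=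
  exists_shift_step j_gt0 LR_gt0 lo_gt0 (e := e ^ 2 / 32) ltac:(lra) eta_gt0.
exists lo', eta'; do 2 split=> //.
move=> n N f lam n_gt0 le_Nn lam_btw n_large f_reg; have nR_gt0 := INR_gt0 n_gt0.
have [q [q_gt0 lo_le Lq_le lamLq_le]] := shift_step n lam n_gt0 lam_btw n_large.
have qR_gt0 := INR_gt0 q_gt0; have nj_gt0 : 0 < INR n ^ j by apply: pow_lt.
have diff_sum_le p : (0 < p < L)%N ->
    Rabs (\rsum_(k < N - p * q) cos (f (k + p * q)%N - f k)) <= e ^ 2 / 16 * INR n.
  move=> /andP [p_gt0 lt_pL].
  have pq_ge : INR q <= INR (p * q) by apply: leq_INR; nia.
  have pq_le : INR (p * q) <= INR L * INR q by rewrite -mult_INR; apply: leq_INR; nia.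
  apply: (small_diff n _ (fun k => f (k + p * q)%N - f k) (lam * INR (p * q))) => //.
  - by lia.
  - by nra.
  - by apply: Rle_trans lo_le _; apply: Rmult_le_compat_r; nra.
  - exact: regular_phase_increment.
apply: Rle_trans (van_der_corput L_gt0 diff_sum_le _) _; first by nra.
have e2n_le : e ^ 2 * INR n <= e * INR n by apply: Rmult_le_compat_r; nra.
have en_gt0 : 0 < e * INR n by apply: Rmult_lt_0_compat.
have en_le : e * INR n <= eps * INR n by apply: Rmult_le_compat_r; lra.
suff : sqrt (INR N * (INR N / INR L + e ^ 2 / 16 * INR n + 3 * (INR L * INR q))) <=
    e / 2 * INR n by lra.
rewrite -[X in _ <= X]sqrt_pow2; last by nra.
apply: sqrt_le_1_alt.
have le_NnR := leq_INR le_Nn; have N_ge0 := pos_INR N.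
have NL_le : 0 <= INR N / INR L <= e ^ 2 / 16 * INR n.
  split; first exact: Rdiv_le_0_compat.
  apply/Rle_div_l => //; move/Rle_div_l: L_ge => /(_ e2_gt0); nra.
have -> : (e / 2 * INR n) ^ 2 = INR n * (e ^ 2 / 4 * INR n) by field.
by apply: Rmult_le_compat; nra.
Qed.

Lemma cos_sums_small_gt0 j : (0 < j)%N -> cos_sums_small j.
Proof.
case: j => // j _; elim: j => [|j IHj]; first exact: cos_sums_small1.
exact: cos_sums_smallS.
Qed.

(** * Power series with uniformly bounded coefficients *)

Definition geom_bounded (M sg : R) (a : nat -> R) : Prop :=
  forall b, Rabs (a b) <= M / sg ^ b.

Lemma geom_bounded_ge0 M sg a : geom_bounded M sg a -> 0 <= M.
Proof. by move=> /(_ O); rewrite /= Rdiv_1_r; apply: Rle_trans; apply: Rabs_pos. Qed.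

Lemma geom_bounded_le M M' sg sg' a : M <= M' -> 0 < sg' <= sg ->
  geom_bounded M sg a -> geom_bounded M' sg' a.
Proof.
move=> le_MM' le_sg a_bd b; apply: Rle_trans (a_bd b) _.
apply: Rmult_le_compat => //; first exact: geom_bounded_ge0 a_bd.
  by apply/Rlt_le/Rinv_0_lt_compat/pow_lt; lra.
by apply: Rinv_le_contravar; [apply: pow_lt | apply: pow_incr]; lra.
Qed.

Lemma geom_bounded_scal c M sg a :
  geom_bounded M sg a -> geom_bounded (Rabs c * M) sg (fun b => c * a b).
Proof.
move=> a_bd b; rewrite Rabs_mult /Rdiv Rmult_assoc.
exact: Rmult_le_compat_l (Rabs_pos c) (a_bd b).
Qed.

Lemma geom_bounded_plus M1 M2 sg a1 a2 : geom_bounded M1 sg a1 ->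
  geom_bounded M2 sg a2 -> geom_bounded (M1 + M2) sg (fun b => a1 b + a2 b).
Proof.
move=> a1_bd a2_bd b; apply: Rle_trans (Rabs_triang _ _) _.
by rewrite /Rdiv Rmult_plus_distr_r; apply: Rplus_le_compat.
Qed.

Lemma succ_le_pow2 b : INR b.+1 <= 2 * 2 ^ b.
Proof.
elim: b => [|b IHb]; first by simpl; lra.
by have := pow_R1_Rle 2 b; rewrite S_INR -tech_pow_Rmult; lra.
Qed.

Lemma geom_bounded_PS_derive M sg a : 0 < sg ->
  geom_bounded M sg a -> geom_bounded (2 * M / sg) (sg / 2) (PS_derive a).
Proof.
move=> sg_gt0 a_bd b; rewrite /PS_derive Rabs_mult Rabs_right; last exact/Rle_ge/pos_INR.
apply: Rle_trans (Rmult_le_compat _ _ _ _ (pos_INR _) (Rabs_pos _)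
  (succ_le_pow2 b) (a_bd b.+1)) _.
right; rewrite /Rdiv Rpow_mult_distr pow_inv /=; field.
by do !split; try apply: pow_nonzero; lra.
Qed.

Lemma geom_bounded_CV_radius M sg a t : 0 < sg ->
  geom_bounded M sg a -> Rabs t < sg -> Rbar_lt (Rabs t) (CV_radius a).
Proof.
move=> sg_gt0 a_bd lt_t_sg; apply: (Rbar_lt_le_trans _ sg) => //.
have [ub _] := CV_radius_bounded a; apply: ub; exists M => b.
have sgb_gt0 := pow_lt _ b sg_gt0.
by rewrite Rabs_mult (Rabs_right (sg ^ b)); [apply/Rle_div_r | lra].
Qed.

Lemma geom_bounded_PSeries_le M sg a t : 0 < sg ->
  geom_bounded M sg a -> Rabs t <= sg / 2 -> Rabs (PSeries a t) <= 2 * M.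
Proof.
move=> sg_gt0 a_bd le_t_sg.
have term_le b : Rabs (a b * t ^ b) <= M * (/ 2) ^ b.
  have sgb_gt0 := pow_lt _ b sg_gt0.
  have tb_le : Rabs (t ^ b) <= (sg / 2) ^ b.
    by rewrite -RPow_abs; apply: pow_incr; split; [exact: Rabs_pos | lra].
  rewrite Rabs_mult.
  apply: Rle_trans (Rmult_le_compat _ _ _ _ (Rabs_pos _) (Rabs_pos _) (a_bd b) tb_le) _.
  by right; rewrite /Rdiv Rpow_mult_distr; field; lra.
have geom_ex : ex_series (fun b => M * (/ 2) ^ b).
  by apply: (@ex_series_scal _ _ M); apply: ex_series_geom; rewrite Rabs_right; lra.
have abs_ex : ex_series (fun b => Rabs (a b * t ^ b)).
  apply: (@ex_series_le R_AbsRing _ _ _ _ geom_ex) => b.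
  by rewrite /norm /= /abs /= Rabs_Rabsolu.
apply: Rle_trans (Series_Rabs _ abs_ex) _.
apply: Rle_trans (Series_le _ _ _ geom_ex) _.
  by move=> b; split; [exact: Rabs_pos | exact: term_le].
by rewrite Series_scal_l Series_geom; [lra | rewrite Rabs_right; lra].
Qed.

Lemma CV_radius_decr_n a k : CV_radius (PS_decr_n a k) = CV_radius a.
Proof.
elim: k => [|k IHk]; first exact: CV_radius_ext.
rewrite -IHk -(CV_radius_decr_1 (PS_decr_n a k)); apply: CV_radius_ext => i.
by rewrite /PS_decr_1 /PS_decr_n; congr a; lia.
Qed.

Lemma PSeries_zero_dichotomy a : Rbar_lt 0 (CV_radius a) ->
  (forall b, a b = 0) \/ locally' 0 (fun t => PSeries a t <> 0).
Proof.
move=> a_cv; have [a_eq0|/not_all_ex_not [b0 ab0_ne0]] := classic (forall b, a b = 0).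
  by left.
right; have nz_ex : exists b, a b != 0 by exists b0; apply/eqP.
have [k /eqP ak_ne0 k_min] := ex_minnP nz_ex.
have PS_factor t : PSeries a t = t ^ k * PSeries (PS_decr_n a k) t.
  apply: PSeries_decr_n_aux => i lt_ik; apply/eqP; apply/negPn/negP => /k_min.
  by lia.
have at0 : PSeries (PS_decr_n a k) 0 <> 0.
  by rewrite PSeries_0 /PS_decr_n (_ : (k + 0)%coq_nat = k) //; lia.
have cont0 : continuity_pt (PSeries (PS_decr_n a k)) 0.
  by apply: PSeries_continuity; rewrite CV_radius_decr_n Rabs_R0.
have near0 : locally 0 (fun t => PSeries (PS_decr_n a k) t <> 0).
  exact: (continuity_pt_filterlim _ _).1 cont0 _ (open_neq 0 _ at0).
apply: filter_imp near0 => t PS_ne0 t_ne0; rewrite PS_factor.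
by apply: Rmult_integral_contrapositive_currified; first exact: pow_nonzero.
Qed.

Lemma locally_0_shift (P : R -> Prop) s : locally 0 P -> locally s (fun t => P (t - s)).
Proof.
move=> [r Pr]; exists r => t t_near; apply: Pr.
by have : Rabs (t - s) < r := t_near; rewrite -{1}[t - s]Rminus_0_r.
Qed.

(** * Families of analytic functions *)

(* What is kept of joint analyticity once the multi-indices in [x] are summed
   out; the coefficients being Lipschitz at [p] makes all [t]-derivatives
   jointly continuous there. *)
Record expansion {m : nat} (F : ('I_m -> R) -> R -> R) (p : 'I_m -> R) (s sg M : R)
    (C : ('I_m -> R) -> nat -> R) : Prop := {
  expansion_radius : 0 < sg;
  expansion_bounded : forall x, ball p sg x -> geom_bounded M sg (C x);
  expansion_lipschitz : forall eta x, 0 < eta <= 1 -> ball p (eta * sg) x ->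
    geom_bounded (eta * M) sg (fun b => C x b - C p b);
  expansion_sum : forall x t, ball p sg x -> ball s sg t -> F x t = PSeries (C x) (t - s)
}.

Definition uniformly_analytic {m : nat} (F : ('I_m -> R) -> R -> R) p s : Prop :=
  exists sg M C, expansion F p s sg M C.

Section UniformlyAnalytic.
Context {m : nat}.
Implicit Types (F G : ('I_m -> R) -> R -> R) (p : 'I_m -> R) (s : R).

Lemma expansion_ball_center F p s sg M C : expansion F p s sg M C -> ball p sg p.
Proof. move=> expF; exact: (ball_center p (mkposreal _ (expansion_radius expF))). Qed.

Lemma expansion_bounded_center F p s sg M C :
  expansion F p s sg M C -> geom_bounded M sg (C p).
Proof. by move=> expF; exact: (expansion_bounded expF (expansion_ball_center expF)). Qed.

Lemma uniformly_analytic_ext F G p s : (forall x t, F x t = G x t) ->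
  uniformly_analytic F p s -> uniformly_analytic G p s.
Proof.
move=> eqFG; suff -> : G = F by [].
by do 2 (apply: functional_extensionality => ?).
Qed.

Lemma uniformly_analytic_scal c F p s :
  uniformly_analytic F p s -> uniformly_analytic (fun x t => c * F x t) p s.
Proof.
move=> [sg [M [C expF]]]; exists sg, (Rabs c * M), (fun x => PS_scal c (C x)).
split=> [|x x_near|eta x eta01 x_near|x t x_near t_near].
- exact: expansion_radius expF.
- exact/geom_bounded_scal/(expansion_bounded expF).
- rewrite (_ : eta * _ = Rabs c * (eta * M)); last ring.
  move=> b; rewrite /PS_scal /scal /= /mult /= -Rmult_minus_distr_l.
  exact: (geom_bounded_scal c (expansion_lipschitz expF eta01 x_near) b).
- by rewrite PSeries_scal (expansion_sum expF).
Qed.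

Lemma uniformly_analytic_plus F G p s : uniformly_analytic F p s ->
  uniformly_analytic G p s -> uniformly_analytic (fun x t => F x t + G x t) p s.
Proof.
move=> [sg1 [M1 [C1 expF]]] [sg2 [M2 [C2 expG]]].
have sg1_gt0 := expansion_radius expF; have sg2_gt0 := expansion_radius expG.
have M1_ge0 := geom_bounded_ge0 (expansion_bounded_center expF).
have M2_ge0 := geom_bounded_ge0 (expansion_bounded_center expG).
pose sg := Rmin sg1 sg2; have sg_gt0 : 0 < sg by apply: Rmin_glb_lt.
have [le_sg1 le_sg2] : sg <= sg1 /\ sg <= sg2 by split; [apply: Rmin_l | apply: Rmin_r].
exists sg, (M1 + M2), (fun x => PS_plus (C1 x) (C2 x)).
have bounded x : ball p sg x -> geom_bounded M1 sg (C1 x) /\ geom_bounded M2 sg (C2 x).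
  move=> x_near; split.
    by apply: geom_bounded_le (expansion_bounded expF (ball_le _ _ _ le_sg1 _ x_near)); lra.
  by apply: geom_bounded_le (expansion_bounded expG (ball_le _ _ _ le_sg2 _ x_near)); lra.
split=> // [x x_near|eta x eta01 x_near b|x t x_near t_near].
- by have [] := bounded x x_near; apply: geom_bounded_plus.
- have lip1 : geom_bounded (eta * M1) sg (fun b => C1 x b - C1 p b).
    apply: geom_bounded_le (expansion_lipschitz expF eta01 _); try lra.
    by apply: ball_le x_near; nra.
  have lip2 : geom_bounded (eta * M2) sg (fun b => C2 x b - C2 p b).
    apply: geom_bounded_le (expansion_lipschitz expG eta01 _); try lra.
    by apply: ball_le x_near; nra.
  have -> : PS_plus (C1 x) (C2 x) b - PS_plus (C1 p) (C2 p) b =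
      (C1 x b - C1 p b) + (C2 x b - C2 p b) by rewrite /PS_plus /plus /=; ring.
  by rewrite Rmult_plus_distr_l; apply: (geom_bounded_plus lip1 lip2).
- have [C1_bd C2_bd] := bounded x x_near.
  rewrite (expansion_sum expF (ball_le _ _ _ le_sg1 _ x_near) (ball_le _ _ _ le_sg1 _ t_near)).
  rewrite (expansion_sum expG (ball_le _ _ _ le_sg2 _ x_near) (ball_le _ _ _ le_sg2 _ t_near)).
  by rewrite PSeries_plus //; apply: CV_radius_inside;
    [apply: geom_bounded_CV_radius C1_bd _ | apply: geom_bounded_CV_radius C2_bd _].
Qed.

Lemma uniformly_analytic_0 p s : uniformly_analytic (fun _ _ => 0) p s.
Proof.
have bounded0 eta : 0 <= eta -> geom_bounded eta 1 (fun=> 0).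
  by move=> eta_ge0 b; rewrite Rabs_R0 pow1; lra.
exists 1, 0, (fun _ _ => 0); split=> [|x _|eta x _ _|x t _ _]; first lra.
- by apply: bounded0; lra.
- by rewrite Rminus_diag; apply: bounded0; lra.
- by rewrite PSeries_const_0.
Qed.

Lemma uniformly_analytic_rsum (I : finType) (F : I -> ('I_m -> R) -> R -> R) p s :
  (forall i, uniformly_analytic (F i) p s) ->
  uniformly_analytic (fun x t => rsum (fun i => F i x t)) p s.
Proof.
move=> anF; rewrite /rsum; elim: (index_enum I) => [|i r IHr].
  by apply: uniformly_analytic_ext (uniformly_analytic_0 p s) => x t; rewrite big_nil.
apply: uniformly_analytic_ext (uniformly_analytic_plus (anF i) IHr) => x t.
by rewrite big_cons.
Qed.

Lemma expansion_is_derive F p s sg M C x t : expansion F p s sg M C ->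
  ball p sg x -> ball s sg t -> is_derive (F x) t (PSeries (PS_derive (C x)) (t - s)).
Proof.
move=> expF x_near t_near; have sg_gt0 := expansion_radius expF.
have t_lt : Rabs (t - s) < sg := t_near.
have dist_gt0 : 0 < sg - Rabs (t - s) by lra.
apply: (is_derive_ext_loc (fun u => PSeries (C x) (u - s))).
  exists (mkposreal _ dist_gt0) => u u_near; symmetry; apply: (expansion_sum expF x_near).
  have {}u_near : Rabs (u - t) < sg - Rabs (t - s) := u_near.
  suff : Rabs (u - s) < sg by [].
  by move: u_near; split_Rabs; lra.
rewrite -[PSeries (PS_derive _) _]Rmult_1_l.
apply: (is_derive_comp (PSeries (C x)) (fun u => u - s)); last by auto_derive.
apply: is_derive_PSeries.
exact: geom_bounded_CV_radius (expansion_bounded expF x_near) t_lt.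
Qed.

Lemma uniformly_analytic_Derive F p s :
  uniformly_analytic F p s -> uniformly_analytic (fun x => Derive (F x)) p s.
Proof.
move=> [sg [M [C expF]]]; have sg_gt0 := expansion_radius expF.
have half_le : sg / 2 <= sg by lra.
exists (sg / 2), (2 * M / sg), (fun x => PS_derive (C x)).
split=> [|x x_near|eta x eta01 x_near b|x t x_near t_near]; first lra.
- apply: geom_bounded_PS_derive => //; apply: (expansion_bounded expF).
  exact: ball_le x_near.
- rewrite /PS_derive -Rmult_minus_distr_l.
  rewrite (_ : eta * _ = 2 * (eta * M) / sg); last by rewrite /Rdiv; ring.
  apply: (geom_bounded_PS_derive sg_gt0 (a := fun b => C x b - C p b)).
  by apply: (expansion_lipschitz expF eta01); apply: ball_le x_near; nra.
- apply: is_derive_unique; apply: (expansion_is_derive expF).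
    exact: ball_le x_near.
  exact: ball_le t_near.
Qed.

Lemma uniformly_analytic_Derive_n F p s k :
  uniformly_analytic F p s -> uniformly_analytic (fun x => Derive_n (F x) k) p s.
Proof. by move=> anF; elim: k => [//|k]; apply: uniformly_analytic_Derive. Qed.

Lemma uniformly_analytic_ex_derive F p s : uniformly_analytic F p s ->
  locally s (fun t => ex_derive (F p) t).
Proof.
move=> [sg [M [C expF]]]; exists (mkposreal _ (expansion_radius expF)) => t t_near.
by eexists; apply: (expansion_is_derive expF (expansion_ball_center expF) t_near).
Qed.

Lemma uniformly_analytic_ex_derive_n F p s n : uniformly_analytic F p s ->
  locally s (fun t => forall k, (k <= n)%N -> ex_derive_n (F p) k t).
Proof.
move=> anF; elim: n => [|n IHn]; first by apply: filter_forall => t [|k].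
have ex_last := uniformly_analytic_ex_derive (uniformly_analytic_Derive_n n anF).
apply: filter_imp (filter_and _ _ IHn ex_last) => t [ex_lt ex_n] k.
by rewrite leq_eqVlt => /predU1P [->|/ex_lt].
Qed.

Lemma uniformly_analytic_is_derive F p s n : uniformly_analytic F p s ->
  is_derive (Derive_n (F p) n) s (Derive_n (F p) n.+1 s).
Proof.
move=> /(uniformly_analytic_Derive_n n) /uniformly_analytic_ex_derive.
by move=> /locally_singleton /Derive_correct.
Qed.

Lemma expansion_dist_center F p s sg M C eta x t : expansion F p s sg M C ->
  0 < eta <= 1 -> ball p (eta * sg) x -> ball s (sg / 2) t ->
  Rabs (F x t - F p t) <= 2 * (eta * M).
Proof.
move=> expF eta01 x_near t_near; have sg_gt0 := expansion_radius expF.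
have x_near' : ball p sg x by apply: ball_le x_near; nra.
have t_near' : ball s sg t by apply: ball_le t_near; lra.
have t_lt : Rabs (t - s) < sg / 2 := t_near.
rewrite (expansion_sum expF x_near' t_near').
rewrite (expansion_sum expF (expansion_ball_center expF) t_near').
have Cx_bd := expansion_bounded expF x_near'; have Cp_bd := expansion_bounded_center expF.
rewrite -PSeries_minus.
- by apply: (geom_bounded_PSeries_le sg_gt0 (expansion_lipschitz expF eta01 x_near)); lra.
- by apply/CV_radius_inside/(geom_bounded_CV_radius sg_gt0 Cx_bd); lra.
- by apply/CV_radius_inside/(geom_bounded_CV_radius sg_gt0 Cp_bd); lra.
Qed.

Lemma uniformly_analytic_continuous F p s : uniformly_analytic F p s ->
  continuous (fun z : ('I_m -> R) * R => F z.1 z.2) (p, s).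
Proof.
move=> anF; have [sg [M [C expF]]] := anF; have sg_gt0 := expansion_radius expF.
have M_ge0 := geom_bounded_ge0 (expansion_bounded_center expF).
have cont_p : continuous (F p) s.
  by apply: ex_derive_continuous; apply: locally_singleton (uniformly_analytic_ex_derive anF).
apply/filterlim_locally => eps; have eps_gt0 := cond_pos eps.
have [r near_s] := (filterlim_locally _ _).1 cont_p (pos_div_2 eps).
pose eta := Rmin 1 (eps / (4 * M + 4)).
have eta01 : 0 < eta <= 1.
  by split; [apply: Rmin_glb_lt; [lra | apply: Rdiv_lt_0_compat; lra] | apply: Rmin_l].
have etaM_lt : 4 * (eta * M) < eps.
  have : eta * (4 * M + 4) <= eps by apply/Rle_div_r; [lra | apply: Rmin_r].
  by nra.
have rad_gt0 : 0 < Rmin r (eta * (sg / 2)).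
  by apply: Rmin_glb_lt; [apply: cond_pos | nra].
have rad_le := Rmin_r r (eta * (sg / 2)).
exists (mkposreal _ rad_gt0) => -[x t] [/= x_near t_near].
have x_dist : Rabs (F x t - F p t) <= 2 * (eta * M).
  by apply: (expansion_dist_center expF eta01);
    [apply: ball_le x_near | apply: ball_le t_near]; nra.
have t_dist : Rabs (F p t - F p s) < eps / 2.
  by apply: near_s; apply: ball_le t_near; apply: Rmin_l.
suff : Rabs (F x t - F p s) < eps by [].
by move: x_dist t_dist; split_Rabs; lra.
Qed.

Lemma uniformly_analytic_zero_dichotomy F p s : uniformly_analytic F p s ->
  locally s (fun t => F p t = 0) \/ locally' s (fun t => F p t <> 0).
Proof.
move=> [sg [M [C expF]]]; have sg_gt0 := expansion_radius expF.
have F_sum : locally s (fun t => F p t = PSeries (C p) (t - s)).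
  exists (mkposreal _ sg_gt0) => t.
  exact: (expansion_sum expF (expansion_ball_center expF)).
have Cp_cv : Rbar_lt 0 (CV_radius (C p)).
  rewrite -Rabs_R0; apply: geom_bounded_CV_radius (expansion_bounded_center expF) _ => //.
  by rewrite Rabs_R0.
have [Cp_eq0|nz] := PSeries_zero_dichotomy Cp_cv; [left | right].
  apply: filter_imp F_sum => t ->.
  by rewrite (PSeries_ext _ (fun=> 0)) // PSeries_const_0.
apply: filter_imp (filter_and _ _ F_sum (locally_0_shift s nz)) => t [-> PS_ne0] ne_ts.
by apply: PS_ne0; lra.
Qed.

Lemma Derive_n_rsum (I : finType) (c : I -> R) (F : I -> ('I_m -> R) -> R -> R) p s n :
  (forall i, uniformly_analytic (F i) p s) ->
  Derive_n (fun t => rsum (fun i => c i * F i p t)) n s =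
  rsum (fun i => c i * Derive_n (F i p) n s).
Proof.
move=> anF; rewrite /rsum.
have [_] : uniformly_analytic (fun x t => \sum_(i <- index_enum I) (c i * F i x t))%R p s /\
    Derive_n (fun t => (\sum_(i <- index_enum I) (c i * F i p t))%R) n s =
    (\sum_(i <- index_enum I) (c i * Derive_n (F i p) n s))%R; last by [].
elim: (index_enum I) => [|i r [an_r Derive_r]].
  split.
    by apply: uniformly_analytic_ext (uniformly_analytic_0 p s) => x t; rewrite big_nil.
  rewrite big_nil (Derive_n_ext _ (fun=> 0)); last by move=> t; rewrite big_nil.
  by case: n => [//|n]; rewrite Derive_n_const.
have an_i := uniformly_analytic_scal (c i) (anF i).
split.
  by apply: uniformly_analytic_ext (uniformly_analytic_plus an_i an_r) => x t; rewrite big_cons.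
rewrite big_cons -Derive_r -RmultE -RplusE -Derive_n_scal_l.
pose Fr x t := (\sum_(j <- r) (c j * F j x t))%R.
rewrite (Derive_n_ext _ (fun t => c i * F i p t + Fr p t)); last by move=> t; rewrite big_cons.
have ex_derive_le G : uniformly_analytic G p s ->
    locally s (fun t => forall k, Nat.le k n -> ex_derive_n (G p) k t).
  move=> /(uniformly_analytic_ex_derive_n n); apply: filter_imp => t ex_t k le_kn.
  by apply: ex_t; lia.
exact: Derive_n_plus (ex_derive_le _ an_i) (ex_derive_le _ an_r).
Qed.
End UniformlyAnalytic.

(** * Summing out the multi-indices *)

Section BoxSums.
Context {m : nat}.
Implicit Types (G H : ('I_m -> nat) -> R) (y : 'I_m -> R) (a : 'I_m -> nat).

Definition box_sum G (K : nat) : R :=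
  rsum (fun a : {ffun 'I_m -> 'I_K.+1} => G (fun j => nat_of_ord (a j))).

Lemma box_sum_incr G K K' :
  (forall a, 0 <= G a) -> (K <= K')%N -> box_sum G K <= box_sum G K'.
Proof.
move=> G_ge0 le_KK'.
pose widen (a : {ffun 'I_m -> 'I_K.+1}) : {ffun 'I_m -> 'I_K'.+1} :=
  [ffun j => widen_ord (le_KK' : (K.+1 <= K'.+1)%N) (a j)].
have widen_inj : injective widen.
  move=> a b /ffunP eq_ab; apply/ffunP => j; apply: val_inj.
  by move: (eq_ab j); rewrite !ffunE => /(congr1 val).
pose G' (a : {ffun 'I_m -> 'I_K'.+1}) := G (fun j => nat_of_ord (a j)).
have le_widen : rsum (fun a : {ffun 'I_m -> 'I_K.+1} => G' (widen a)) <= box_sum G K'.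
  by apply: (rsum_inj_le widen_inj) => a; apply: G_ge0.
apply: Rle_trans le_widen; right; apply: rsum_ext => a; congr G.
by apply: functional_extensionality => j; rewrite ffunE.
Qed.

Lemma box_sum_cvg G B : (forall K, box_sum (fun a => Rabs (G a)) K <= B) ->
  is_lim_seq (box_sum G) (real (Lim_seq (box_sum G))).
Proof.
move=> G_le.
have [l1 abs_cv] : ex_finite_lim_seq (box_sum (fun a => Rabs (G a))).
  apply: (ex_finite_lim_seq_incr _ B) => // K.
  by apply: box_sum_incr => // a; apply: Rabs_pos.
have [l2 sum_cv] : ex_finite_lim_seq (box_sum (fun a => Rabs (G a) + G a)).
  apply: (ex_finite_lim_seq_incr _ (2 * B)) => K.
    by apply: box_sum_incr => // a; split_Rabs; lra.
  apply: (Rle_trans _ (2 * box_sum (fun a => Rabs (G a)) K)); last by have := G_le K; lra.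
  by rewrite /box_sum -rsum_scal_l; apply: rsum_le => a; split_Rabs; lra.
suff cv : is_lim_seq (box_sum G) (l2 - l1) by rewrite (is_lim_seq_unique _ _ cv).
apply: is_lim_seq_ext (is_lim_seq_minus' _ _ _ _ sum_cv abs_cv) => K.
by rewrite /box_sum -rsum_minus; apply: rsum_ext => a; ring.
Qed.

Lemma box_sum_dominated G H B :
  (forall a, Rabs (G a) <= H a) -> (forall K, box_sum H K <= B) ->
  is_lim_seq (box_sum G) (real (Lim_seq (box_sum G))) /\ Rabs (Lim_seq (box_sum G)) <= B.
Proof.
move=> le_GH H_le.
have G_le K : box_sum (fun a => Rabs (G a)) K <= B.
  by apply: Rle_trans (H_le K); apply: rsum_le => a; apply: le_GH.
have cv := box_sum_cvg G_le; split=> //.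
apply: (is_lim_seq_le (fun K => Rabs (box_sum G K)) (fun=> B) (Rabs (Lim_seq (box_sum G))) B).
- by move=> K; apply: Rle_trans (Rabs_rsum_le _) (G_le K).
- exact: (is_lim_seq_abs _ _ cv).
- exact: is_lim_seq_const.
Qed.

Definition monomial y a : R := rprod (fun j => y j ^ a j).

Lemma Rabs_monomial y a : Rabs (monomial y a) = monomial (fun j => Rabs (y j)) a.
Proof.
apply: (big_ind2 (fun u v => Rabs u = v)) => [|u1 v1 u2 v2 <- <-|j _].
- exact: Rabs_R1.
- exact: Rabs_mult.
- by rewrite RPow_abs.
Qed.

Lemma monomial_ge0 y a : (forall j, 0 <= y j) -> 0 <= monomial y a.
Proof.
move=> y_ge0; apply: (big_ind (Rle 0)) => [|u v|j _]; first exact: Rle_0_1.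
  exact: Rmult_le_pos.
exact: pow_le.
Qed.

Lemma monomial_le y z a : (forall j, 0 <= y j <= z j) -> monomial y a <= monomial z a.
Proof.
move=> yz; suff : 0 <= monomial y a <= monomial z a by case.
apply: (big_ind2 (fun u v => 0 <= u <= v)) => [|u1 v1 u2 v2 uv1 uv2|j _].
- by split; [exact: Rle_0_1 | right].
- by rewrite -!RmultE; split; [apply: Rmult_le_pos | apply: Rmult_le_compat]; tauto.
- by have := yz j; split; [apply: pow_le; tauto | apply: pow_incr].
Qed.

Lemma Rabs_monomial_le y sg a :
  (forall j, Rabs (y j) <= sg) -> Rabs (monomial y a) <= monomial (fun=> sg) a.
Proof.
move=> y_le; rewrite Rabs_monomial; apply: monomial_le => j.
by split; [exact: Rabs_pos | exact: y_le].
Qed.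

Lemma monomial_scal eta y a :
  monomial (fun j => eta * y j) a = eta ^ (\sum_j a j)%N * monomial y a.
Proof.
rewrite /monomial /rprod RmultE RpowE -GRing.prodrXr -big_split.
by apply: eq_bigr => j _; rewrite Rpow_mult_distr RmultE !RpowE.
Qed.

Lemma monomial_dist_le eta sg y a : 0 <= sg -> 0 <= eta <= 1 ->
  (forall j, Rabs (y j) <= eta * sg) ->
  Rabs (monomial y a - monomial (fun=> 0) a) <= eta * monomial (fun=> sg) a.
Proof.
move=> sg_ge0 eta01 y_le.
have sg_mon_ge0 : 0 <= monomial (fun=> sg) a by apply: monomial_ge0.
have [/eqP|deg_gt0] := posnP (\sum_j a j)%N.
  rewrite sum_nat_eq0 => /forallP a_eq0.
  have mon1 z : monomial z a = 1.
    by rewrite /monomial /rprod big1 // => j _; rewrite (eqP (a_eq0 j)).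
  by rewrite !mon1 in sg_mon_ge0 *; rewrite Rminus_diag Rabs_R0; lra.
have mon0 : monomial (fun=> 0) a = 0.
  have -> : (fun=> 0) = (fun j : 'I_m => 0 * 0).
    by apply: functional_extensionality => j; rewrite Rmult_0_l.
  by rewrite monomial_scal pow_i ?Rmult_0_l //; lia.
rewrite mon0 Rminus_0_r; apply: Rle_trans (Rabs_monomial_le _ y_le) _.
rewrite monomial_scal; apply: Rmult_le_compat_r => //.
case: (\sum_j a j)%N deg_gt0 => // k _; rewrite /= -[X in _ <= X]Rmult_1_r.
by apply: Rmult_le_compat_l; [lra | rewrite -(pow1 k); apply: pow_incr].
Qed.
End BoxSums.

(** * Local expansions of analytic families *)

Lemma sum_n_rsum (a : nat -> R) n : sum_n a n = \rsum_(k < n.+1) a k.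
Proof.
elim: n => [|n IHn]; first by rewrite sum_O /rsum big_ord1.
by rewrite sum_Sn IHn [RHS]rsum_recr.
Qed.

Lemma is_series_rsum (a : nat -> R) (l : R) :
  is_series a l <-> is_lim_seq (fun n => \rsum_(k < n) a k) l.
Proof.
rewrite (is_lim_seq_incr_1 (fun n => \rsum_(k < n) a k)).
suff -> : (fun n => \rsum_(k < n.+1) a k) = sum_n a by [].
by apply: functional_extensionality => n; rewrite sum_n_rsum.
Qed.

Lemma tannery (u : nat -> nat -> R) (C w : nat -> R) (l : R) :
  ex_series w -> (forall K b, Rabs (u K b) <= w b) ->
  (forall b, is_lim_seq (fun K => u K b) (C b)) ->
  is_lim_seq (fun K => \rsum_(b < K.+1) u K b) l -> is_series C l.
Proof.
move=> [W /is_series_rsum w_sum] u_le u_cv sum_cv.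
have w_ge0 b : 0 <= w b by apply: Rle_trans (u_le O b); apply: Rabs_pos.
have w_le_W n : \rsum_(b < n) w b <= W.
  by apply: (is_lim_seq_incr_compare _ _ w_sum) => k; rewrite rsum_recr; have := w_ge0 k; lra.
have tail B : Rabs (l - \rsum_(b < B) C b) <= W - \rsum_(b < B) w b.
  have head_cv : is_lim_seq (fun K => \rsum_(b < B) u K b) (\rsum_(b < B) C b).
    by apply: (is_lim_seq_rsum (u := fun K (b : 'I_B) => u K b)) => b; apply: u_cv.
  have dist_cv := is_lim_seq_abs _ _ (is_lim_seq_minus' _ _ _ _ sum_cv head_cv).
  apply: is_lim_seq_le_loc _ dist_cv (is_lim_seq_const _); exists B => K le_BK.
  have split_sum (v : nat -> R) : \rsum_(b < K.+1) v b =
      \rsum_(b < B) v b + \rsum_(k < K.+1 - B) v (B + k)%N.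
    by rewrite -rsum_cat subnKC; last lia.
  rewrite (split_sum (u K)) Rplus_minus_l; apply: Rle_trans (Rabs_rsum_le _) _.
  apply: (Rle_trans _ (\rsum_(k < K.+1 - B) w (B + k)%N)); first by apply: rsum_le.
  by have := w_le_W K.+1; rewrite (split_sum w); lra.
apply/is_series_rsum.
apply: (is_lim_seq_le_le (fun B => l - (W - \rsum_(b < B) w b)) _
                         (fun B => l + (W - \rsum_(b < B) w b))).
- by move=> B; have := tail B; split_Rabs; lra.
- rewrite -{2}[l]Rminus_0_r -(Rminus_diag W).
  by do 2 apply: is_lim_seq_minus' (is_lim_seq_const _) _.
- rewrite -{2}[l]Rplus_0_r -(Rminus_diag W).
  apply: is_lim_seq_plus' (is_lim_seq_const _) _.
  exact: is_lim_seq_minus' (is_lim_seq_const _) _.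
Qed.

Section AnalyticExpansion.
Variables (m : nat) (c : ('I_m -> nat) -> nat -> R) (p : 'I_m -> R) (s sg M : R).
Hypothesis sg_gt0 : 0 < sg.
Hypothesis corner_le :
  forall K, ps_abs_partial c p s (fun j => p j + sg) (s + sg) K <= M.

Definition ps_majorant b (a : 'I_m -> nat) : R := Rabs (c a b) * monomial (fun=> sg) a.
Definition ps_term x b (a : 'I_m -> nat) : R := c a b * monomial (fun j => x j - p j) a.
Definition ps_coef x b : R := real (Lim_seq (box_sum (ps_term x b))).

Lemma ps_majorant_ge0 b a : 0 <= ps_majorant b a.
Proof.
by apply: Rmult_le_pos; [exact: Rabs_pos | apply: monomial_ge0 => _; lra].
Qed.

Lemma box_sum_majorant_le b K : box_sum (ps_majorant b) K <= M / sg ^ b.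
Proof.
apply: Rle_trans (box_sum_incr (K' := maxn K b) (ps_majorant_ge0 b) _) _; first lia.
set K' := maxn K b; have lt_bK : (b < K'.+1)%N by rewrite /K'; lia.
apply/Rle_div_r; first exact: pow_lt.
apply: Rle_trans (corner_le K'); rewrite /ps_abs_partial /box_sum Rmult_comm -rsum_scal_l.
apply: rsum_le => a.
pose col (i : 'I_K'.+1) := ps_majorant i (fun j => nat_of_ord (a j)) * sg ^ i.
rewrite (_ : _ * _ = col (Ordinal lt_bK)); last by rewrite /col /=; ring.
apply: Rle_trans (rsum_ge_term _ _) _.
  by move=> i; apply: Rmult_le_pos (ps_majorant_ge0 _ _) _; apply: pow_le; lra.
right; apply: rsum_ext => i; rewrite /col /ps_majorant !Rplus_minus_l.
rewrite (Rabs_right sg); last lra; congr (_ * _ * _).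
by apply: eq_bigr => j _; rewrite Rplus_minus_l (Rabs_right sg) //; lra.
Qed.

Lemma ps_term_le x b a : ball p sg x -> Rabs (ps_term x b a) <= ps_majorant b a.
Proof.
move=> x_near; rewrite /ps_term Rabs_mult; apply: Rmult_le_compat_l; first exact: Rabs_pos.
by apply: Rabs_monomial_le => j; apply: Rlt_le; apply: x_near.
Qed.

Lemma ps_coef_cvg x b : ball p sg x -> is_lim_seq (box_sum (ps_term x b)) (ps_coef x b).
Proof.
move=> x_near.
by have [] := box_sum_dominated (fun a => ps_term_le b a x_near) (box_sum_majorant_le b).
Qed.

Lemma ps_coef_bounded x : ball p sg x -> geom_bounded M sg (ps_coef x).
Proof.
move=> x_near b.
by have [] := box_sum_dominated (fun a => ps_term_le b a x_near) (box_sum_majorant_le b).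
Qed.

Lemma ps_coef_lipschitz eta x : 0 < eta <= 1 -> ball p (eta * sg) x ->
  geom_bounded (eta * M) sg (fun b => ps_coef x b - ps_coef p b).
Proof.
move=> eta01 x_near b.
have x_near' : ball p sg x by apply: ball_le x_near; nra.
have p_near : ball p sg p by exact: (ball_center p (mkposreal _ sg_gt0)).
pose diff a := ps_term x b a - ps_term p b a.
have diff_le a : Rabs (diff a) <= eta * ps_majorant b a.
  rewrite /diff /ps_term -Rmult_minus_distr_l Rabs_mult /ps_majorant.
  rewrite [X in _ <= X](_ : _ = Rabs (c a b) * (eta * monomial (fun=> sg) a)); last ring.
  apply: Rmult_le_compat_l; first exact: Rabs_pos.
  rewrite (_ : (fun j => p j - p j) = fun=> 0); last first.
    by apply: functional_extensionality => j; rewrite Rminus_diag.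
  by apply: monomial_dist_le => [||j]; [lra | lra | apply: Rlt_le; apply: x_near].
have [K|_ dist_le] := box_sum_dominated (B := eta * M / sg ^ b) diff_le.
  rewrite /box_sum rsum_scal_l /Rdiv Rmult_assoc.
  by apply: Rmult_le_compat_l; [lra | apply: box_sum_majorant_le].
suff <- : real (Lim_seq (box_sum diff)) = ps_coef x b - ps_coef p b by [].
have cv := is_lim_seq_minus' _ _ _ _ (ps_coef_cvg (b := b) x_near')
   (ps_coef_cvg (b := b) p_near).
rewrite (is_lim_seq_unique (box_sum diff) (ps_coef x b - ps_coef p b)) //.
by apply: is_lim_seq_ext cv => K; rewrite /box_sum -rsum_minus.
Qed.

Lemma ps_partialE x t K :
  ps_partial c p s x t K = \rsum_(b < K.+1) (box_sum (ps_term x b) K * (t - s) ^ b).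
Proof.
rewrite /ps_partial rsum_exchange; apply: rsum_ext => b.
by rewrite [RHS]Rmult_comm /box_sum -rsum_scal_l; apply: rsum_ext => a; rewrite [RHS]Rmult_comm.
Qed.

Lemma ps_coef_is_pseries x t (l : R) : ball p sg x -> Rabs (t - s) < sg ->
  is_lim_seq (ps_partial c p s x t) l -> is_pseries (ps_coef x) (t - s) l.
Proof.
move=> x_near t_lt lim_ps; pose z := Rabs (t - s) / sg.
have z01 : 0 <= z < 1.
  split; first by apply: Rdiv_le_0_compat => //; apply: Rabs_pos.
  exact/(Rdiv_lt_1 _ _ sg_gt0).
apply: (is_series_ext (fun b => ps_coef x b * (t - s) ^ b)).
  by move=> b; rewrite pow_n_pow /scal /= /mult /= Rmult_comm.
apply: (tannery (u := fun K b => box_sum (ps_term x b) K * (t - s) ^ b)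
  (w := fun b => M * z ^ b)).
- by apply: (@ex_series_scal _ _ M); apply: ex_series_geom; rewrite Rabs_right; lra.
- move=> K b; rewrite Rabs_mult -RPow_abs.
  have -> : M * z ^ b = M / sg ^ b * Rabs (t - s) ^ b.
    by rewrite /z /Rdiv Rpow_mult_distr pow_inv; ring.
  apply: Rmult_le_compat_r; first exact/pow_le/Rabs_pos.
  apply: Rle_trans (Rabs_rsum_le _) _; apply: Rle_trans (box_sum_majorant_le b K).
  by apply: rsum_le => a; apply: ps_term_le.
- by move=> b; apply: is_lim_seq_mult' (ps_coef_cvg (b := b) x_near) (is_lim_seq_const _).
- by apply: is_lim_seq_ext lim_ps => K; rewrite ps_partialE.
Qed.
End AnalyticExpansion.

Lemma analytic_at_uniformly_analytic (m : nat) (F : ('I_m -> R) -> R -> R) p s :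
  analytic_at F p s -> uniformly_analytic F p s.
Proof.
move=> [r [r_gt0 [c F_ps]]]; pose sg := r / 2.
have sg_gt0 : 0 < sg by rewrite /sg; lra.
have sg_lt (u : R) : Rabs (u + sg - u) < r by rewrite Rplus_minus_l Rabs_right /sg; lra.
have [M corner_le] := (F_ps (fun j => p j + sg) (s + sg) (fun j => sg_lt (p j)) (sg_lt s)).1.
exists sg, M, (ps_coef c p); split=> // [x x_near|eta x eta01 x_near|x t x_near t_near].
- exact: ps_coef_bounded corner_le _ x_near.
- exact: ps_coef_lipschitz corner_le _ _ eta01 x_near.
have x_lt j : Rabs (x j - p j) < r.
  by have : Rabs (x j - p j) < sg := x_near j; rewrite /sg; lra.
have t_lt : Rabs (t - s) < sg := t_near.
symmetry; apply/is_pseries_unique/(ps_coef_is_pseries sg_gt0 corner_le x_near t_lt).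
by apply: (F_ps x t x_lt _).2; move: t_lt; rewrite /sg; lra.
Qed.

(** * Compactness and isolated zeros *)

Lemma bounded_nE n (T : Tn n R) :
  bounded_n n (mk_Tn n (fun=> 0)) (mk_Tn n (fun=> 1)) T <->
  forall k, (k < n)%N -> 0 <= coeff_Tn 0 T k <= 1.
Proof.
elim: n T => [|n IHn] /= => [[]|[t T]]; first by split.
rewrite IHn; split=> [[t01 T01] [|k] //|T01]; first exact: T01.
by split; [apply: (T01 O) | move=> k; apply: (T01 k.+1)].
Qed.

Lemma close_n_coeff n e (T T' : Tn n R) k :
  close_n n e T T' -> (k < n)%N -> Rabs (coeff_Tn 0 T k - coeff_Tn 0 T' k) < e.
Proof.
elim: n T T' k => [//|n IHn] [t T] [t' T'] [|k] /= [close_t close_T] lt_kn //.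
exact: IHn.
Qed.

Lemma cube_lebesgue n (V : ('I_n -> R) -> R -> Prop) :
  (forall p, in_cube p -> exists r, 0 < r /\ V p r) ->
  exists e, 0 < e /\ forall x, in_cube x ->
    exists p r, [/\ in_cube p, V p r, e <= r & ball p r x].
Proof.
move=> V_local; pose vec (T : Tn n R) : 'I_n -> R := fun j => coeff_Tn 0 T j.
have radius_ex T : exists r : posreal, in_cube (vec T) -> V (vec T) r.
  have [/V_local [r [r_gt0 Vr]]|out] := classic (in_cube (vec T)).
    by exists (mkposreal r r_gt0).
  by exists (mkposreal 1 Rlt_0_1).
pose radius T := proj1_sig (constructive_indefinite_description _ (radius_ex T)).
have radiusP T : in_cube (vec T) -> V (vec T) (radius T).
  exact: (proj2_sig (constructive_indefinite_description _ (radius_ex T))).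
have [e cover] := compactness_value n (mk_Tn n (fun=> 0)) (mk_Tn n (fun=> 1)) radius.
exists e; split=> [|x x_cube]; first exact: cond_pos.
pose v k := oapp x 0 (insub k).
have coeff_v (j : 'I_n) : coeff_Tn 0 (mk_Tn n v) j = x j.
  by rewrite coeff_Tn_bij; [rewrite /v valK | have := ltn_ord j; lia].
have [|T [T_bd [T_close e_le]]] := NNPP _ (cover (mk_Tn n v) _).
  by apply/bounded_nE => k lt_kn; rewrite -[k]/(nat_of_ord (Ordinal lt_kn)) coeff_v.
have T_cube : in_cube (vec T) by move=> j; apply: (bounded_nE _).1 T_bd _ _.
exists (vec T), (radius T); split=> //; first exact: radiusP.
by move=> j; have := close_n_coeff T_close (ltn_ord j); rewrite coeff_v.
Qed.

Lemma additive_interval_ind (P : R -> R -> Prop) a b : a <= b ->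
  (forall u v w, a <= u <= v -> v <= w <= b -> P u v -> P v w -> P u w) ->
  (forall s, a <= s <= b -> exists r, 0 < r /\
     forall u v, a <= u <= v -> v <= b -> s - r < u -> v < s + r -> P u v) ->
  P a b.
Proof.
move=> le_ab P_add P_local; pose E v := a <= v <= b /\ P a v.
have Ea : E a by split; [lra | have [|r [r_gt0]] := P_local a; [lra | apply; lra]].
have [||T [ubT lubT]] := completeness E; [by exists b => v [[]] | by exists a |].
have le_aT : a <= T by apply: ubT.
have le_Tb : T <= b by apply: lubT => v [[]].
have [|r [r_gt0 P_near]] := P_local T; first lra.
have [v [[v_btw Pv] lt_v]] : exists v, E v /\ T - r < v.
  apply: NNPP => no_v; suff : T <= T - r by lra.
  by apply: lubT => v Ev; apply: Rnot_lt_le => lt_v; apply: no_v; exists v.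
have le_vT : v <= T by apply: ubT.
pose w := Rmin b (T + r / 2); have le_wb : w <= b by apply: Rmin_l.
have le_w : w <= T + r / 2 by apply: Rmin_r.
have le_vw : v <= w by apply: Rmin_glb; lra.
have Pw : P a w by apply: (P_add a v w) => //; try lra; apply: P_near; lra.
have le_wT : w <= T by apply: ubT; split=> //; lra.
suff <- : w = b by [].
by move: le_wT; rewrite /w /Rmin; case: Rle_dec => // _; lra.
Qed.

Lemma locally_punctured (P : R -> Prop) s : locally' s P ->
  locally s (fun t => t <> s -> locally t P).
Proof.
move=> /locally_locally; apply: filter_imp => t P_near ne_ts.
by apply: filter_imp (filter_and _ _ P_near (open_neq s t ne_ts)) => u [Pu /Pu].
Qed.

Lemma zeros_isolated (g : R -> R) a b :
  (forall s, a <= s <= b ->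
     locally s (fun t => g t = 0) \/ locally' s (fun t => g t <> 0)) ->
  (exists t, a <= t <= b /\ g t <> 0) ->
  forall s, a <= s <= b -> locally' s (fun t => g t <> 0).
Proof.
pose Z s := locally s (fun t => g t = 0); pose E s := locally' s (fun t => g t <> 0).
move=> dichotomy [t0 [t0_btw gt0_ne0]].
have not_both s : Z s -> E s -> False.
  move=> Zs Es; have Zr : at_right s (fun t => g t = 0) by apply: filter_le_within.
  have Er : at_right s (fun t => g t <> 0).
    apply: (filter_imp (F := locally s) (fun t => t <> s -> g t <> 0)) Es => t gt_ne0 lt_st.
    by apply: gt_ne0; lra.
  by have [t []] := filter_ex _ (filter_and _ _ Zr Er).
have open_dichotomy s : a <= s <= b -> locally s Z \/ locally s E.
  move=> /dichotomy [Zs|Es]; [left; exact: locally_locally | right].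
  apply: filter_imp (locally_punctured Es) => t Et.
  by have [->|ne_ts] := Req_dec t s; [|apply/filter_le_within/Et].
have [allZ|//] : (forall s, a <= s <= b -> Z s) \/ (forall s, a <= s <= b -> E s).
  apply: (additive_interval_ind (P := fun u v =>
    (forall s, u <= s <= v -> Z s) \/ (forall s, u <= s <= v -> E s))); first lra.
  - move=> u v w le_uv le_vw [uv|uv] [vw|vw].
    + by left=> s s_btw; case: (Rle_lt_dec s v) => le_sv; [apply: uv | apply: vw]; lra.
    + by case: (not_both v); [apply: uv | apply: vw]; lra.
    + by case: (not_both v); [apply: vw | apply: uv]; lra.
    + by right=> s s_btw; case: (Rle_lt_dec s v) => le_sv; [apply: uv | apply: vw]; lra.
  - move=> s s_btw; have inside (r : posreal) u v x :
        s - r < u -> v < s + r -> u <= x <= v -> ball s r x.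
      move=> lt_u lt_v x_btw; suff : Rabs (x - s) < r by [].
      by apply: Rabs_def1; lra.
    have [[r near_s]|[r near_s]] := open_dichotomy s s_btw; exists r; split.
    + exact: cond_pos.
    + by move=> u v _ _ lt_u lt_v; left=> x /(inside r _ _ _ lt_u lt_v) /near_s.
    + exact: cond_pos.
    + by move=> u v _ _ lt_u lt_v; right=> x /(inside r _ _ _ lt_u lt_v) /near_s.
by case: gt0_ne0; apply: locally_singleton (allZ t0 t0_btw).
Qed.

(** * Uniform bounds for cosine sums *)

Lemma fdiff_derivative_bounds j (D : nat -> R -> R) a b step c C u : 0 < step ->
  (forall i t, a <= t <= b -> is_derive (D i) t (D i.+1 t)) ->
  (forall t, a <= t <= b -> c <= D j t <= C) ->
  a <= u -> u + INR j * step <= b ->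
  c * step ^ j <= fdiff j (fun k => D O (u + INR k * step)) O <= C * step ^ j.
Proof.
move=> step_gt0; elim: j D b c C => [|j IHj] D b c C derD D_btw le_au le_ub.
  rewrite /= Rmult_0_l Rplus_0_r !Rmult_1_r; apply: D_btw.
  by move: le_ub; rewrite /=; lra.
rewrite S_INR in le_ub.
have jstep_ge0 : 0 <= INR j * step by apply: Rmult_le_pos; [apply: pos_INR | lra].
pose Dstep i t := D i (t + step) - D i t.
have -> : fdiff j.+1 (fun k => D O (u + INR k * step)) O =
    fdiff j (fun k => Dstep O (u + INR k * step)) O.
  apply: (fdiff_ext j (f := fun i => D O (u + INR i.+1 * step) - D O (u + INR i * step))) => i.
  by rewrite S_INR; congr (D _ _ - _); ring.
rewrite -!tech_pow_Rmult -!Rmult_assoc.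
apply: (IHj Dstep (b - step)) => [i t t_btw|t t_btw||]; try lra.
  apply: (is_derive_minus (fun t => D i (t + step)) (D i)); last by apply: derD; lra.
  rewrite -[D i.+1 (t + step)]Rmult_1_l.
  by apply: (is_derive_comp (D i) (fun t => t + step)); [apply: derD; lra | auto_derive].
have [||x [x_btw]] := MVT_gen (D j) t (t + step) (D j.+1);
  rewrite ?Rmin_left ?Rmax_right; try lra.
- by move=> x x_btw; apply: derD; lra.
- move=> x x_btw; apply/continuity_pt_filterlim/(ex_derive_continuous (D j)).
  by eexists; apply: derD; lra.
rewrite Rplus_minus_l /Dstep => ->.
move: x_btw; rewrite Rmin_left ?Rmax_right; try lra.
by move=> x_btw; have := D_btw x ltac:(lra); nra.
Qed.

Section DerivativeTest.
Variables (D : nat -> R -> R) (a b : R) (n A B : nat) (rho th : R).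
Hypothesis n_gt0 : (0 < n)%N.
Hypothesis derD : forall i t, a <= t <= b -> is_derive (D i) t (D i.+1 t).
Hypothesis A_ge : a * INR n <= INR A.
Hypothesis B_le : INR B <= b * INR n.
Hypothesis rho_ge0 : 0 <= rho.

Let phase k := rho * D O (INR (A + k)%N / INR n) + th.

Lemma fdiff_phase_bounds i c C k : (0 < i)%N -> (A + k + i <= B)%N ->
  (forall t, a <= t <= b -> c <= D i t <= C) ->
  c * (rho / INR n ^ i) <= fdiff i phase k <= C * (rho / INR n ^ i).
Proof.
move=> i_gt0 le_kB D_btw; have nR_gt0 := INR_gt0 n_gt0.
have u_ge : a <= INR (A + k) / INR n.
  by apply/Rle_div_r => //; apply: Rle_trans A_ge _; apply: leq_INR; lia.
have u_le : INR (A + k) / INR n + INR i * / INR n <= b.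
  rewrite /Rdiv -Rmult_plus_distr_r -plus_INR; apply/Rle_div_l => //.
  by apply: Rle_trans B_le; apply: leq_INR; lia.
have [lo up] := fdiff_derivative_bounds (Rinv_0_lt_compat _ nR_gt0) derD D_btw u_ge u_le.
suff -> : fdiff i phase k =
    rho * fdiff i (fun l => D O (INR (A + k) / INR n + INR l * / INR n)) O.
  have lo' := Rmult_le_compat_l _ _ _ rho_ge0 lo.
  have up' := Rmult_le_compat_l _ _ _ rho_ge0 up.
  by move: lo' up'; rewrite pow_inv /Rdiv; lra.
rewrite -[k in LHS]add0n -fdiff_shift -fdiff_scal_l.
case: i i_gt0 {le_kB D_btw u_le lo up} => // i _.
rewrite -[RHS]Rplus_0_r -(fdiff_const i th O) -fdiff_plus.
apply: fdiff_ext => l; rewrite /phase; congr (_ * D _ _ + _).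
by rewrite (_ : (A + (l + k) = (A + k) + l)%N) ?plus_INR; [field; lra | lia].
Qed.

Lemma regular_phase_derivatives j delta M : (0 < j)%N ->
  (forall t, a <= t <= b -> delta <= D j t <= M) ->
  (forall t, a <= t <= b -> Rabs (D j.+1 t) <= M) ->
  regular_phase j n (B - A - j.+1) delta M (rho / INR n ^ j) phase.
Proof.
move=> j_gt0 Dj_btw DSj_le; have nR_gt0 := INR_gt0 n_gt0.
split=> k lt_k; first by apply: fdiff_phase_bounds => //; lia.
apply: Rabs_le.
have -> : M * (rho / INR n ^ j) / INR n = M * (rho / INR n ^ j.+1).
  by rewrite -tech_pow_Rmult; field; split; [apply: pow_nonzero |]; lra.
rewrite Ropp_mult_distr_l; apply: fdiff_phase_bounds => //; first lia.
by move=> t /DSj_le; split_Rabs; lra.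
Qed.
End DerivativeTest.

Lemma cos_sum_derivative_test j delta M eps :
  (0 < j)%N -> 0 < delta -> 0 < M -> 0 < eps ->
  exists lo eta, 0 < lo /\ 0 < eta /\
  forall (D : nat -> R -> R) a b n A B rho th,
    (0 < n)%N -> (B <= A + n)%N -> a * INR n <= INR A -> INR B <= b * INR n ->
    (forall i t, a <= t <= b -> is_derive (D i) t (D i.+1 t)) ->
    (forall t, a <= t <= b -> delta <= D j t <= M) ->
    (forall t, a <= t <= b -> Rabs (D j.+1 t) <= M) ->
    lo <= rho -> rho / INR n ^ j <= eta ->
    Rabs (\rsum_(k < B - A) cos (rho * D O (INR (A + k)%N / INR n) + th)) <=
    eps * INR n + INR j.+1.
Proof.
move=> j_gt0 delta_gt0 M_gt0 eps_gt0.
have [lo [eta [lo_gt0 [eta_gt0 small]]]] :=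
  cos_sums_small_gt0 j_gt0 delta_gt0 M_gt0 eps_gt0.
exists lo, eta; do 2 split=> //.
move=> D a b n A B rho th n_gt0 le_BA A_ge B_le derD Dj_btw DSj_le lo_le le_eta.
have nj_gt0 : 0 < INR n ^ j by apply/pow_lt/INR_gt0.
pose f k := rho * D O (INR (A + k)%N / INR n) + th.
pose S N := \rsum_(k < N) cos (f k).
have trunc_le : Rabs (S (B - A)%N - S (B - A - j.+1)%N) <= INR j.+1.
  rewrite -[INR j.+1]Rmult_1_r.
  by apply: (rsum_trunc_dist _ _ (f := fun k => cos (f k))) => k; apply: Rabs_cos_le1.
have triang := Rabs_triang_inv (S (B - A)%N) (S (B - A - j.+1)%N).
rewrite -[X in Rabs X]/(S (B - A)%N).
suff main_le : Rabs (S (B - A - j.+1)%N) <= eps * INR n by lra.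
apply: (small n _ f (rho / INR n ^ j) n_gt0); first lia.
- by split=> //; apply: Rdiv_lt_0_compat; lra.
- by apply: Rle_trans lo_le _; right; field; apply: Rgt_not_eq.
- by apply: (regular_phase_derivatives (a := a) (b := b)) => //; lra.
Qed.

Section Oscillation.
Variables (m : nat) (F : ('I_m -> R) -> R -> R) (q : nat) (rho : nat -> R).
Implicit Types (p x : 'I_m -> R) (a b c e s : R).

Definition osc_bound p e a b : Prop :=
  exists r N, 0 < r /\ forall x n (A B : nat) th,
    in_cube x -> ball p r x -> (N <= n)%N -> (A <= B)%N ->
    a * INR n <= INR A -> INR B <= b * INR n ->
    Rabs (\rsum_(k < B - A) cos (rho n * F x (INR (A + k)%N / INR n) + th)) <= e * INR n.

Definition oscillates p a b : Prop := forall e, 0 < e -> osc_bound p e a b.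

Lemma osc_bound_le p e e' a b : e <= e' -> osc_bound p e a b -> osc_bound p e' a b.
Proof.
move=> le_ee' [r [N [r_gt0 bound]]]; exists r, N; split=> // x n A B th *.
apply: Rle_trans (bound x n A B th _ _ _ _ _ _) _ => //.
by apply: Rmult_le_compat_r => //; apply: pos_INR.
Qed.

Lemma osc_bound_length p a b : osc_bound p (b - a) a b.
Proof.
exists 1, O; split=> [|x n A B th _ _ _ le_AB A_ge B_le]; first lra.
apply: Rle_trans (Rabs_rsum_le_const (c := 1) _) _; first by move=> k; apply: Rabs_cos_le1.
by rewrite minus_INR; [lra | lia].
Qed.

Lemma osc_bound_split p e1 e2 eta a b c : 0 <= e1 -> 0 <= e2 -> 0 < eta ->
  osc_bound p e1 a b -> osc_bound p e2 b c -> osc_bound p (e1 + e2 + eta) a c.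
Proof.
move=> e1_ge0 e2_ge0 eta_gt0 [r1 [N1 [r1_gt0 bound1]]] [r2 [N2 [r2_gt0 bound2]]].
have [N3 [N3_gt0 N3_ge]] := exists_INR_ge (1 / eta).
exists (Rmin r1 r2), (maxn (maxn N1 N2) N3); split; first exact: Rmin_glb_lt.
move=> x n A B th x_cube x_near n_ge le_AB A_ge B_le.
have x_near1 : ball p r1 x by apply: ball_le x_near; apply: Rmin_l.
have x_near2 : ball p r2 x by apply: ball_le x_near; apply: Rmin_r.
have nR_gt0 : 0 < INR n by apply: INR_gt0; lia.
have n_large : 1 <= INR n * eta.
  by apply/(Rle_div_l _ _ _ eta_gt0)/(Rle_trans _ _ _ N3_ge)/leq_INR; lia.
have [le_Bb|lt_bB] := Rle_lt_dec (INR B) (b * INR n).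
  by apply: Rle_trans (bound1 x n A B th _ _ _ _ _ _) _ => //; [lia | nra].
have [le_bA|lt_Ab] := Rle_lt_dec (b * INR n) (INR A).
  by apply: Rle_trans (bound2 x n A B th _ _ _ _ _ _) _ => //; [lia | nra].
have [E [E_le lt_E]] := nfloor_ex (b * INR n) ltac:(have := pos_INR A; lra).
have le_AE : (A <= E)%N.
  by rewrite -ltnS; apply/ssrnat.ltP/INR_lt; rewrite S_INR; lra.
have lt_EB : (E < B)%N by apply/ssrnat.ltP/INR_lt; lra.
pose v k := cos (rho n * F x (INR k / INR n) + th).
have left_le : Rabs (\rsum_(k < E - A) v (A + k)%N) <= e1 * INR n by apply: bound1 => //; lia.
have right_le : Rabs (\rsum_(k < B - E.+1) v (E.+1 + k)%N) <= e2 * INR n.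
  by apply: bound2 => //; [lia | rewrite S_INR; lra].
have mid_le : Rabs (v E) <= 1 := Rabs_cos_le1 _.
have -> : \rsum_(k < B - A) v (A + k)%N =
    \rsum_(k < E - A) v (A + k)%N + v E + \rsum_(k < B - E.+1) v (E.+1 + k)%N.
  have -> : v E = v (A + (E - A))%N by rewrite subnKC.
  rewrite -(rsum_recr _ (fun k => v (A + k)%N)).
  rewrite (_ : (B - A)%N = ((E - A).+1 + (B - E.+1))%N); last lia.
  rewrite (rsum_cat _ _ (fun k => v (A + k)%N)); congr (_ + _).
  by apply: rsum_ext => k; congr v; lia.
by move: left_le right_le mid_le; split_Rabs; lra.
Qed.

Lemma oscillates_chain p a b : a <= b ->
  (forall s, a <= s <= b -> exists r, 0 < r /\ forall u v, a <= u <= v -> v <= b ->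
     s - r < u -> v < s + r -> oscillates p u v) ->
  oscillates p a b.
Proof.
move=> le_ab; apply: additive_interval_ind => // u v w _ _ osc_uv osc_vw e e_gt0.
rewrite (_ : e = e / 3 + e / 3 + e / 3); last field.
by apply: (osc_bound_split (b := v)); try lra; [apply: osc_uv | apply: osc_vw]; lra.
Qed.

Hypothesis q_gt0 : (0 < q)%N.
Hypothesis F_analytic : forall p s, in_cube p -> 0 <= s <= 1 -> uniformly_analytic F p s.
Hypothesis rho_infty : is_lim_seq rho p_infty.
Hypothesis rho_small : is_lim_seq (fun n => rho n / INR n ^ q) 0.

Lemma rho_range lo eta : 0 < eta ->
  exists N, forall n, (N <= n)%N -> lo <= rho n /\ rho n / INR n ^ q <= eta.
Proof.
move=> eta_gt0.
have [N1 N1_ge] := (is_lim_seq_spec _ _).2 rho_infty lo.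
have [N2 N2_ge] := (is_lim_seq_spec _ _).2 rho_small (mkposreal _ eta_gt0).
exists (maxn N1 N2) => n n_ge; split; first by apply/Rlt_le/N1_ge; lia.
have : Rabs (rho n / INR n ^ q - 0) < eta by apply: N2_ge; lia.
by split_Rabs; lra.
Qed.

Lemma locally_derivative_bounds p s : in_cube p -> 0 <= s <= 1 -> Derive_n (F p) q s <> 0 ->
  exists sgn delta M, [/\ sgn = 1 \/ sgn = -1, 0 < delta, 0 < M &
    locally (p, s) (fun z : ('I_m -> R) * R =>
      delta <= sgn * Derive_n (F z.1) q z.2 <= M /\ Rabs (sgn * Derive_n (F z.1) q.+1 z.2) <= M)].
Proof.
move=> p_cube s_btw; set g := Derive_n (F p) q s => g_ne0.
have g_gt0 : 0 < Rabs g by apply: Rabs_pos_lt.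
have [sgn [sgn_unit sgn_g]] : exists sgn, (sgn = 1 \/ sgn = -1) /\ sgn * g = Rabs g.
  by case: (Rle_lt_dec 0 g) => g_sign; [exists 1 | exists (-1)]; split; auto; split_Rabs; lra.
pose g' := Derive_n (F p) q.+1 s.
have cont i eps (eps_gt0 : 0 < eps) : locally (p, s) (fun z : ('I_m -> R) * R =>
    Rabs (Derive_n (F z.1) i z.2 - Derive_n (F p) i s) < eps).
  have cont_i := uniformly_analytic_continuous
    (uniformly_analytic_Derive_n i (F_analytic p_cube s_btw)).
  exact: (filterlim_locally _ _).1 cont_i (mkposreal _ eps_gt0).
exists sgn, (Rabs g / 2), (2 * Rabs g + Rabs g' + 1).
split=> //; [lra | by have := Rabs_pos g'; lra |].
have half_gt0 : 0 < Rabs g / 2 by lra.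
have near := cont q _ half_gt0; have near' := cont q.+1 _ Rlt_0_1.
apply: filter_imp (filter_and _ _ near near') => z [near_g near_g'].
have g'_ge0 := Rabs_pos g'; rewrite Rabs_mult.
have -> : Rabs sgn = 1 by case: sgn_unit => ->; rewrite ?Rabs_Ropp Rabs_R1.
have : Rabs (sgn * Derive_n (F z.1) q z.2 - Rabs g) < Rabs g / 2.
  rewrite -{1}sgn_g -Rmult_minus_distr_l Rabs_mult.
  by case: sgn_unit => ->; rewrite ?Rabs_Ropp Rabs_R1 Rmult_1_l.
move=> /Rabs_def2 [lt_up lt_lo]; split; first lra.
by move: near_g'; rewrite -/g' /=; split_Rabs; lra.
Qed.

Lemma oscillates_near_nonzero p s : in_cube p -> 0 <= s <= 1 -> Derive_n (F p) q s <> 0 ->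
  exists r, 0 < r /\ forall a b, 0 <= a -> b <= 1 -> s - r < a -> b < s + r ->
    oscillates p a b.
Proof.
move=> p_cube s_btw g_ne0.
have [sgn [delta [M [sgn_unit delta_gt0 M_gt0 [r bounds]]]]] :=
  locally_derivative_bounds p_cube s_btw g_ne0.
exists r; split=> [|a b a_ge0 b_le1 lt_a lt_b e e_gt0]; first exact: cond_pos.
have e2_gt0 : 0 < e / 2 by lra.
have [lo [eta [lo_gt0 [eta_gt0 test]]]] :=
  cos_sum_derivative_test q_gt0 delta_gt0 M_gt0 e2_gt0.
have [N1 N1_range] := rho_range lo eta_gt0.
have [N2 [N2_gt0 N2_ge]] := exists_INR_ge (INR q.+1 / (e / 2)).
exists r, (maxn N1 N2); split=> [|x n A B th x_cube x_near n_ge le_AB A_ge B_le].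
  exact: cond_pos.
have [rho_ge rho_le] := N1_range n ltac:(lia); have nR_gt0 : 0 < INR n by apply: INR_gt0; lia.
have q_le : INR q.+1 <= INR n * (e / 2).
  by apply/(Rle_div_l _ _ _ e2_gt0)/(Rle_trans _ _ _ N2_ge)/leq_INR; lia.
have near t : a <= t <= b -> ball (p, s) r (x, t).
  by move=> t_btw; split=> //; suff : Rabs (t - s) < r by []; apply: Rabs_def1; lra.
have -> : \rsum_(k < B - A) cos (rho n * F x (INR (A + k)%N / INR n) + th) =
    \rsum_(k < B - A) cos (rho n * (sgn * F x (INR (A + k)%N / INR n)) + sgn * th).
  apply: rsum_ext => k; case: sgn_unit => ->; first by congr cos; ring.
  by rewrite -cos_neg; congr cos; ring.
pose D i t := sgn * Derive_n (F x) i t.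
apply: Rle_trans (test D a b n A B _ _ _ _ _ _ _ _ _ _ _) _ => //.
- by lia.
- have le_Bn : (B <= n)%N by apply: INR_leq; nra.
  by lia.
- move=> i t t_btw; apply: is_derive_scal; apply: uniformly_analytic_is_derive.
  by apply: F_analytic => //; lra.
- by move=> t /near /bounds [].
- by move=> t /near /bounds [].
- by lra.
Qed.

Lemma oscillates_empty p a b : b < a -> oscillates p a b.
Proof. by move=> lt_ba e e_gt0; apply: osc_bound_le (osc_bound_length p a b); lra. Qed.

Lemma oscillates_nonzero p a b : in_cube p -> 0 <= a -> b <= 1 ->
  (forall s, a <= s <= b -> Derive_n (F p) q s <> 0) -> oscillates p a b.
Proof.
move=> p_cube a_ge0 b_le1 g_ne0.
have [le_ab|] := Rle_lt_dec a b; last exact: oscillates_empty.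
apply: oscillates_chain => // s s_btw.
have [||r [r_gt0 osc]] := oscillates_near_nonzero (s := s) p_cube; [lra | exact: g_ne0 |].
by exists r; split=> // u v *; apply: osc; lra.
Qed.

(* A zero [s] is cut out with an interval of length [2 eta]. *)
Lemma oscillates_near_isolated_zero p s : in_cube p -> 0 <= s <= 1 ->
  locally' s (fun t => Derive_n (F p) q t <> 0) ->
  exists r, 0 < r /\ forall a b, 0 <= a -> b <= 1 -> s - r < a -> b < s + r ->
    oscillates p a b.
Proof.
move=> p_cube s_btw [r g_ne0]; have r_gt0 := cond_pos r.
exists r; split=> // a b a_ge0 b_le1 lt_a lt_b e e_gt0.
pose eta := e / 6; have eta_gt0 : 0 < eta by rewrite /eta; lra.
have osc_off u v : 0 <= u -> v <= 1 -> s - r < u -> v < s + r -> v < s \/ s < u ->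
    osc_bound p eta u v.
  move=> *; apply: oscillates_nonzero => // [t t_btw]; apply: g_ne0; last lra.
  by suff : Rabs (t - s) < r by []; apply: Rabs_def1; lra.
have osc_left : osc_bound p eta a (s - eta) by apply: osc_off; lra.
have osc_mid := osc_bound_length p (s - eta) (s + eta).
have osc_right : osc_bound p eta (s + eta) b by apply: osc_off; lra.
have osc_left_mid : osc_bound p (eta + (s + eta - (s - eta)) + eta) a (s + eta).
  by apply: osc_bound_split osc_left osc_mid; lra.
apply: osc_bound_le (osc_bound_split _ _ eta_gt0 osc_left_mid osc_right); try lra.
by rewrite /eta; lra.
Qed.

Lemma oscillates_unit_interval p : in_cube p ->
  (exists t, 0 <= t <= 1 /\ Derive_n (F p) q t <> 0) -> oscillates p 0 1.
Proof.
move=> p_cube g_ne0; apply: oscillates_chain => [|s s_btw]; first lra.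
have dichotomy t (t_btw : 0 <= t <= 1) := uniformly_analytic_zero_dichotomy
  (uniformly_analytic_Derive_n q (F_analytic p_cube t_btw)).
have [r [r_gt0 osc]] :=
  oscillates_near_isolated_zero p_cube s_btw (zeros_isolated dichotomy g_ne0 s_btw).
by exists r; split=> // u v *; apply: osc; lra.
Qed.

Lemma cos_sum_uniform :
  (forall x, in_cube x -> exists t, 0 <= t <= 1 /\ Derive_n (F x) q t <> 0) ->
  forall e, 0 < e -> exists N, forall n x th, (N <= n)%N -> in_cube x ->
    Rabs (\rsum_(k < n) cos (rho n * F x (INR k / INR n) + th)) <= e * INR n.
Proof.
move=> g_ne0 e e_gt0.
have [|d [d_gt0 cover]] := cube_lebesgue (V := fun p r => forall x n th,
    in_cube x -> ball p r x -> / r <= INR n ->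
    Rabs (\rsum_(k < n) cos (rho n * F x (INR k / INR n) + th)) <= e * INR n).
  move=> p p_cube.
  have [r [N [r_gt0 bound]]] := oscillates_unit_interval p_cube (g_ne0 p p_cube) e_gt0.
  have N_gt0 : 0 < / INR N.+1 by apply/Rinv_0_lt_compat/INR_gt0.
  have rad_gt0 : 0 < Rmin r (/ INR N.+1) by apply: Rmin_glb_lt.
  exists (Rmin r (/ INR N.+1)); split=> // x n th x_cube x_near n_ge.
  have le_Nn : (N.+1 <= n)%N.
    apply: INR_leq; apply: Rle_trans n_ge; rewrite -[X in X <= _]Rinv_inv.
    by apply: Rinv_le_contravar; last exact: Rmin_r.
  have := bound x n O n th x_cube; rewrite subn0; apply; rewrite ?Rmult_0_l ?Rmult_1_l //.
  - by apply: ball_le x_near; apply: Rmin_l.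
  - exact: ltnW.
  - exact: Rle_refl.
  - exact: Rle_refl.
have [N [_ N_ge]] := exists_INR_ge (/ d).
exists N => n x th le_Nn x_cube; have [p [r [p_cube bound le_dr x_near]]] := cover x x_cube.
apply: bound => //; apply: (Rle_trans _ (/ d)); first exact: Rinv_le_contravar.
exact: Rle_trans N_ge (leq_INR le_Nn).
Qed.
End Oscillation.

(** * Fejer's kernel *)

Lemma cos_period_Z x (z : Z) : cos (x + 2 * PI * IZR z) = cos x.
Proof.
have period_nat y n : cos (y + 2 * PI * INR n) = cos y.
  by rewrite -(cos_period y n); congr cos; ring.
have [z_ge0|z_lt0] := Z_le_gt_dec 0 z.
  by rewrite -(Z2Nat.id z) // -INR_IZR_INZ period_nat.
rewrite -(period_nat (x + _) (Z.to_nat (Z.opp z))) INR_IZR_INZ Z2Nat.id; last lia.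
by rewrite opp_IZR; congr cos; ring.
Qed.

Lemma cos_neq1 x : - (2 * PI) < x < 2 * PI -> x <> 0 -> cos x <> 1.
Proof.
move=> x_btw x_ne0 cos1; have := cos_2a_sin (x / 2).
rewrite (_ : 2 * (x / 2) = x) ?cos1; last field.
move=> sin2; have sin0 : sin (x / 2) = 0 by nra.
have [x_lt0|x_gt0] : x < 0 \/ 0 < x by lra.
  by have := sin_gt_0 (- (x / 2)); rewrite sin_neg; lra.
by have := sin_gt_0 (x / 2); lra.
Qed.

Lemma cos_sum_full_turns n alpha beta (z : Z) :
  INR n * beta = 2 * PI * IZR z -> cos beta <> 1 ->
  \rsum_(k < n) cos (alpha + INR k * beta) = 0.
Proof.
move=> full_turns cos_ne1; pose S a := \rsum_(k < n) cos (a + INR k * beta).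
have shift a : S (a + beta) = S a.
  have := rsum_telescope n (fun k => cos (a + INR k * beta)).
  rewrite full_turns cos_period_Z Rmult_0_l Rplus_0_r Rminus_diag rsum_minus.
  rewrite (rsum_ext (F := fun k : 'I_n => cos (a + INR k.+1 * beta))
                    (G := fun k : 'I_n => cos (a + beta + INR k * beta))).
    by rewrite -/(S a) -/(S (a + beta)); lra.
  by move=> k; rewrite S_INR; congr cos; ring.
have average : S (alpha + beta) + S (alpha - beta) = 2 * cos beta * S alpha.
  rewrite /S -rsum_plus -rsum_scal_l; apply: rsum_ext => k.
  rewrite (_ : alpha + beta + _ = (alpha + INR k * beta) + beta); last ring.
  rewrite (_ : alpha - beta + _ = (alpha + INR k * beta) - beta); last ring.
  by rewrite cos_plus cos_minus; ring.
have : (1 - cos beta) * S alpha = 0.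
  have := shift (alpha - beta); rewrite (_ : alpha - beta + beta = alpha); last ring.
  by have := shift alpha; lra.
by case/Rmult_integral; [lra | apply].
Qed.

Lemma cos_sum_roots_of_unity (Q : nat) (h : Z) alpha :
  h <> Z0 -> Z.lt (Z.abs h) (Z.of_nat Q) ->
  \rsum_(w < Q) cos (alpha + 2 * PI * IZR h * (INR w / INR Q)) = 0.
Proof.
move=> h_ne0 lt_hQ; have QR_gt0 : 0 < INR Q by apply: INR_gt0; lia.
pose beta := 2 * PI * IZR h / INR Q.
have h_btw : - INR Q < IZR h < INR Q.
  by rewrite INR_IZR_INZ -opp_IZR; split; apply: IZR_lt; lia.
have hR_ne0 : IZR h <> 0 by apply: not_0_IZR.
have PI_gt0 := PI_RGT_0.
rewrite -[RHS](@cos_sum_full_turns Q alpha beta h).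
- by apply: rsum_ext => w; congr cos; rewrite /beta; field; lra.
- by rewrite /beta; field; lra.
- apply: cos_neq1.
    by rewrite /beta; split; [apply/Rlt_div_r | apply/Rlt_div_l] => //; nra.
  by rewrite /beta => /Rmult_integral [|/Rinv_neq_0_compat]; [case/Rmult_integral|]; lra.
Qed.

Lemma Rinv_INR_ge0 n : 0 <= / INR n.
Proof.
case: n => [|n]; first by rewrite Rinv_0; lra.
exact/Rlt_le/Rinv_0_lt_compat/INR_gt0.
Qed.

Definition fejer (M : nat) (x : R) : R :=
  / INR M * \rsum_(a < M) \rsum_(b < M) cos (INR a * x - INR b * x).

Lemma fejer_sqr M x : fejer M x =
  / INR M * ((\rsum_(a < M) cos (INR a * x)) ^ 2 + (\rsum_(a < M) sin (INR a * x)) ^ 2).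
Proof. by rewrite /fejer (cos_sum_sqr (fun a : 'I_M => INR a * x)). Qed.

Lemma fejer_ge0 M x : 0 <= fejer M x.
Proof.
rewrite fejer_sqr; apply: Rmult_le_pos; first exact: Rinv_INR_ge0.
by apply: Rplus_le_le_0_compat; apply: pow2_ge_0.
Qed.

(* With [z = exp (i x)], this is [|1 - z|^2 |1 + z + ... + z^(M-1)|^2 = |1 - z^M|^2]. *)
Lemma one_sub_cos_mul_fejer M x : (1 - cos x) * fejer M x = / INR M * (1 - cos (INR M * x)).
Proof.
rewrite fejer_sqr; set C := \rsum_(a < M) cos _; set S := \rsum_(a < M) sin _.
have re_part : (1 - cos x) * C + sin x * S = 1 - cos (INR M * x).
  rewrite /C /S; elim: M {C S} => [|M IHM].
    by rewrite !rsum_ord0 /= Rmult_0_l cos_0; ring.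
  rewrite (rsum_recr M (fun a => cos (INR a * x))) (rsum_recr M (fun a => sin (INR a * x))).
  by rewrite S_INR Rmult_plus_distr_r Rmult_1_l cos_plus; lra.
have im_part : (1 - cos x) * S - sin x * C = - sin (INR M * x).
  rewrite /C /S; elim: M {C S re_part} => [|M IHM].
    by rewrite !rsum_ord0 /= Rmult_0_l sin_0; ring.
  rewrite (rsum_recr M (fun a => cos (INR a * x))) (rsum_recr M (fun a => sin (INR a * x))).
  by rewrite S_INR Rmult_plus_distr_r Rmult_1_l sin_plus; lra.
have unit_x := sin2_cos2 x; have unit_Mx := sin2_cos2 (INR M * x).
rewrite /Rsqr in unit_x unit_Mx.
suff : (1 - cos x) * (C ^ 2 + S ^ 2) = 1 - cos (INR M * x) by move=> <-; ring.
suff : 2 * ((1 - cos x) * (C ^ 2 + S ^ 2)) = 2 * (1 - cos (INR M * x)) by lra.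
transitivity (((1 - cos x) * C + sin x * S) ^ 2 + ((1 - cos x) * S - sin x * C) ^ 2).
  transitivity (((1 - cos x) ^ 2 + sin x * sin x) * (C ^ 2 + S ^ 2)); last ring.
  rewrite (_ : (1 - cos x) ^ 2 + sin x * sin x = 2 * (1 - cos x)); first ring.
  by rewrite /= Rmult_1_r; lra.
by rewrite re_part im_part /= !Rmult_1_r; lra.
Qed.

Lemma fejer_concentration M x : (1 - cos x) * fejer M x <= 2 / INR M.
Proof.
rewrite one_sub_cos_mul_fejer /Rdiv [X in _ <= X]Rmult_comm.
apply: Rmult_le_compat_l; first exact: Rinv_INR_ge0.
by have := COS_bound (INR M * x); lra.
Qed.

Lemma fejer_mul_cos M x A :
  fejer M x * cos A = / INR M * \rsum_(a < M) \rsum_(b < M) cos (A + (INR a - INR b) * x).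
Proof.
pose odd_sum := \rsum_(a < M) \rsum_(b < M) sin ((INR a - INR b) * x).
have odd_sum0 : odd_sum = 0.
  suff : odd_sum = -1 * odd_sum by lra.
  rewrite {1}/odd_sum rsum_exchange -rsum_scal_l; apply: rsum_ext => a.
  rewrite -rsum_scal_l; apply: rsum_ext => b.
  by rewrite (_ : (INR b - _) * x = - ((INR a - INR b) * x)) ?sin_neg; ring.
suff -> : \rsum_(a < M) \rsum_(b < M) cos (A + (INR a - INR b) * x) =
    cos A * \rsum_(a < M) \rsum_(b < M) cos (INR a * x - INR b * x) - sin A * odd_sum.
  by rewrite odd_sum0 /fejer; ring.
rewrite /odd_sum -!rsum_scal_l -rsum_minus; apply: rsum_ext => a.
rewrite -!rsum_scal_l -rsum_minus; apply: rsum_ext => b.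
by rewrite -Rmult_minus_distr_r cos_plus.
Qed.

Lemma fejer_mean (M Q : nat) u : (0 < M)%N -> (M <= Q)%N ->
  / INR Q * \rsum_(w < Q) fejer M (2 * PI * (u - INR w / INR Q)) = 1.
Proof.
move=> M_gt0 le_MQ; have MR_gt0 := INR_gt0 M_gt0; have QR_gt0 : 0 < INR Q by apply: INR_gt0; lia.
rewrite rsum_scal_l rsum_exchange.
pose x (w : 'I_Q) := 2 * PI * (u - INR w / INR Q).
have row_sum (a : 'I_M) :
    \rsum_(w < Q) \rsum_(b < M) cos (INR a * x w - INR b * x w) = INR Q.
  rewrite rsum_exchange -[RHS](rsum_delta a); apply: rsum_ext => b.
  case: eqP => [<-|/eqP ne_ab].
    rewrite -[RHS]Rmult_1_r -rsum_const; apply: rsum_ext => w.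
    by rewrite Rminus_diag cos_0.
  pose h := Z.sub (Z.of_nat b) (Z.of_nat a).
  have hE : IZR h = INR b - INR a by rewrite minus_IZR -!INR_IZR_INZ.
  have := ltn_ord a; have := ltn_ord b => lt_bM lt_aM.
  have ne_ab' : nat_of_ord a <> b by move=> /val_inj/eqP; apply/negP.
  rewrite -[RHS](@cos_sum_roots_of_unity Q h (- (2 * PI * IZR h * u))); try lia.
  by apply: rsum_ext => w; congr cos; rewrite hE /x; ring.
rewrite (rsum_ext row_sum) rsum_const; field; lra.
Qed.

Lemma fejer_approx (G : R -> R) e C (M Q : nat) u : (0 < M)%N -> (M <= Q)%N -> 0 <= C ->
  (forall w, Rabs (G u - G w) <= e + C * (1 - cos (2 * PI * (u - w)))) ->
  Rabs (G u - / INR Q *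
    \rsum_(w < Q) (G (INR w / INR Q) * fejer M (2 * PI * (u - INR w / INR Q)))) <=
  e + 2 * C / INR M.
Proof.
move=> M_gt0 le_MQ C_ge0 G_modulus; have QR_gt0 : 0 < INR Q by apply: INR_gt0; lia.
have MR_gt0 := INR_gt0 M_gt0.
pose K w := fejer M (2 * PI * (u - INR w / INR Q)).
have K_sum : \rsum_(w < Q) K w = INR Q.
  transitivity (INR Q * (/ INR Q * \rsum_(w < Q) K w)); first by field; lra.
  by rewrite /K fejer_mean // Rmult_1_r.
have -> : G u - / INR Q * \rsum_(w < Q) (G (INR w / INR Q) * K w) =
    / INR Q * \rsum_(w < Q) ((G u - G (INR w / INR Q)) * K w).
  rewrite (rsum_ext (F := fun w : 'I_Q => (G u - G (INR w / INR Q)) * K w)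
    (G := fun w : 'I_Q => G u * K w - G (INR w / INR Q) * K w)); last by move=> w; ring.
  rewrite rsum_minus rsum_scal_l K_sum Rmult_minus_distr_l; congr (_ - _).
  by field; lra.
have Qinv_gt0 : 0 < / INR Q by apply: Rinv_0_lt_compat.
rewrite Rabs_mult (Rabs_right (/ INR Q)); last lra.
have -> : e + 2 * C / INR M = / INR Q * \rsum_(w < Q) (e * K w + C * (2 / INR M)).
  by rewrite rsum_plus rsum_scal_l rsum_const K_sum; field; lra.
apply: Rmult_le_compat_l; first lra.
apply: Rle_trans (Rabs_rsum_le _) _; apply: rsum_le => w.
have K_ge0 : 0 <= K w := fejer_ge0 _ _.
rewrite Rabs_mult (Rabs_right (K w)); last lra.
apply: Rle_trans (Rmult_le_compat_r _ _ _ K_ge0 (G_modulus _)) _.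
rewrite Rmult_plus_distr_r Rmult_assoc; apply/Rplus_le_compat_l/Rmult_le_compat_l => //.
exact: fejer_concentration.
Qed.

(** * Iterated integrals of periodic functions *)

Record torus_uniform (g : (nat -> R) -> R) : Prop := {
  torus_uniform_continuous : forall e, 0 < e -> exists r, 0 < r /\
    forall u v, (forall k, Rabs (u k - v k) < r) -> Rabs (g u - g v) <= e;
  torus_uniform_periodic : forall v (z : nat -> Z), g (fun k => v k + IZR (z k)) = g v;
  torus_uniform_bounded : exists B, forall v, Rabs (g v) <= B
}.

Definition upd (v : nat -> R) (j : nat) (s : R) : nat -> R :=
  fun k => if Nat.eqb k j then s else v k.

Lemma torus_uniform_upd g j s : torus_uniform g -> torus_uniform (fun v => g (upd v j s)).
Proof.
move=> g_unif; split.
- move=> e e_gt0; have [r [r_gt0 g_cont]] := torus_uniform_continuous g_unif e_gt0.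
  exists r; split=> // u v uv_near; apply: g_cont => k.
  by rewrite /upd; case: Nat.eqb; rewrite // Rminus_diag Rabs_R0.
- move=> v z.
  pose z' k := if Nat.eqb k j then Z0 else z k.
  rewrite -(torus_uniform_periodic g_unif (upd v j s) z').
  congr g; apply: functional_extensionality => k; rewrite /upd /z'.
  by case: Nat.eqb; rewrite ?Rplus_0_r.
- by have [B g_le] := torus_uniform_bounded g_unif; exists B.
Qed.

Lemma torus_uniform_upd_continuous g e : torus_uniform g -> 0 < e -> exists r, 0 < r /\
  forall v j s t, Rabs (s - t) < r -> Rabs (g (upd v j s) - g (upd v j t)) <= e.
Proof.
move=> g_unif e_gt0; have [r [r_gt0 g_cont]] := torus_uniform_continuous g_unif e_gt0.
exists r; split=> // v j s t st_near; apply: g_cont => k.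
by rewrite /upd; case: Nat.eqb; rewrite // Rminus_diag Rabs_R0.
Qed.

Lemma unif_cont_ex_RInt (I : R -> R) a b :
  (forall e, 0 < e -> exists r, 0 < r /\
     forall s t, Rabs (s - t) < r -> Rabs (I s - I t) <= e) ->
  ex_RInt I a b.
Proof.
move=> I_cont; apply: ex_RInt_continuous => s _.
apply/continuity_pt_filterlim => e e_gt0.
have [r [r_gt0 I_near]] := I_cont (e / 2) ltac:(lra); exists r; split=> // t [_ ts_near].
by apply: Rle_lt_trans (I_near t s ts_near) _; lra.
Qed.

Lemma iter_int_dist n : forall g1 g2 e, torus_uniform g1 -> torus_uniform g2 ->
  (forall v, Rabs (g1 v - g2 v) <= e) -> Rabs (iter_int n g1 - iter_int n g2) <= e.
Proof.
elim: n => [|n IHn] g1 g2 e g1_unif g2_unif dist_le /=; first exact: dist_le.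
pose J g s := iter_int n (fun v => g (upd v n s)).
have exJ g : torus_uniform g -> ex_RInt (J g) 0 1.
  move=> g_unif; apply: unif_cont_ex_RInt => eps eps_gt0.
  have [r [r_gt0 g_cont]] := torus_uniform_upd_continuous g_unif eps_gt0.
  exists r; split=> // s t st_near.
  by apply: IHn => [||v]; try exact: torus_uniform_upd; apply: g_cont.
have -> : RInt (J g1) 0 1 - RInt (J g2) 0 1 = RInt (fun s => minus (J g1 s) (J g2 s)) 0 1.
  by rewrite (RInt_minus (V := R_CompleteNormedModule) (J g1) (J g2)) //; apply: exJ.
have ex_diff := ex_RInt_minus _ _ _ _ (exJ g1 g1_unif) (exJ g2 g2_unif).
have := abs_RInt_le_const _ 0 1 e Rle_0_1 ex_diff; rewrite Rminus_0_r Rmult_1_l; apply=> s _.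
by apply: IHn => [||v]; try exact: torus_uniform_upd; apply: dist_le.
Qed.

Lemma iter_int_upd_continuous n g e : torus_uniform g -> 0 < e -> exists r, 0 < r /\
  forall s t, Rabs (s - t) < r ->
    Rabs (iter_int n (fun v => g (upd v n s)) - iter_int n (fun v => g (upd v n t))) <= e.
Proof.
move=> g_unif e_gt0.
have [r [r_gt0 g_cont]] := torus_uniform_upd_continuous g_unif e_gt0.
exists r; split=> // s t st_near.
by apply: iter_int_dist => [||v]; try exact: torus_uniform_upd; apply: g_cont.
Qed.

Lemma riemann_sum_dist (I : R -> R) e r (Q : nat) :
  (forall a b, ex_RInt I a b) -> (0 < Q)%N -> / INR Q < r ->
  (forall s t, Rabs (s - t) < r -> Rabs (I s - I t) <= e) ->
  Rabs (/ INR Q * \rsum_(w < Q) I (INR w / INR Q) - RInt I 0 1) <= e.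
Proof.
move=> exI Q_gt0 lt_Qr I_cont; have QR_gt0 := INR_gt0 Q_gt0.
have Qinv_gt0 : 0 < / INR Q by apply: Rinv_0_lt_compat.
suff partial n : Rabs (/ INR Q * \rsum_(w < n) I (INR w / INR Q) - RInt I 0 (INR n / INR Q))
    <= INR n / INR Q * e.
  by have := partial Q; rewrite (_ : INR Q / INR Q = 1) ?Rmult_1_l //; field; lra.
elim: n => [|n IHn].
  rewrite rsum_ord0 /= /Rdiv !Rmult_0_l Rmult_0_r RInt_point /zero /= Rminus_0_r Rabs_R0.
  exact: Rle_refl.
set a := INR n / INR Q in IHn *; set b := INR n.+1 / INR Q.
have bE : b = a + / INR Q by rewrite /b /a S_INR; field; lra.
have step_le : Rabs (RInt (fun s => I s - I a) a b) <= (b - a) * e.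
  apply: abs_RInt_le_const; first lra.
    by apply: ex_RInt_minus => //; apply: ex_RInt_const.
  by move=> t t_btw; apply: I_cont; rewrite Rabs_right; lra.
have stepE : RInt (fun s => I s - I a) a b = RInt I a b - / INR Q * I a.
  rewrite (RInt_minus (V := R_CompleteNormedModule) I (fun=> I a)) ?RInt_const //.
    by rewrite bE /minus /plus /opp /scal /= /mult /=; congr (_ + - _); ring.
  exact: ex_RInt_const.
rewrite -(RInt_Chasles I 0 a b) // (rsum_recr n (fun w => I (INR w / INR Q))) -/a /plus /=.
have -> : / INR Q * (\rsum_(w < n) I (INR w / INR Q) + I a) - (RInt I 0 a + RInt I a b) =
    (/ INR Q * \rsum_(w < n) I (INR w / INR Q) - RInt I 0 a) - (RInt I a b - / INR Q * I a).
  by ring.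
rewrite -stepE; apply: Rle_trans (Rabs_triang _ _) _; rewrite Rabs_Ropp.
by rewrite bE in step_le *; lra.
Qed.

Lemma exists_nearest_integer x : exists z : Z, Rabs (x - IZR z) <= 1 / 2.
Proof.
exists (Int_part (x + 1 / 2)); apply: Rabs_le.
by have := base_Int_part (x + 1 / 2); lra.
Qed.

Lemma cos_2PI_far x r : 0 <= r <= Rabs x -> Rabs x <= 1 / 2 ->
  cos (2 * PI * x) <= cos (2 * PI * r).
Proof.
move=> r_btw x_le; have PI_gt0 := PI_RGT_0.
have -> : cos (2 * PI * x) = cos (2 * PI * Rabs x).
  by rewrite /Rabs; case: Rcase_abs => // _; rewrite -cos_neg; congr cos; ring.
by apply: cos_decr_1; nra.
Qed.

Lemma korovkin_modulus (G : R -> R) B r e u w : 0 < r <= 1 / 2 -> 0 <= e ->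
  (forall x (z : Z), G (x + IZR z) = G x) -> (forall x, Rabs (G x) <= B) ->
  (forall x y, Rabs (x - y) < r -> Rabs (G x - G y) <= e) ->
  Rabs (G u - G w) <= e + 2 * B / (1 - cos (2 * PI * r)) * (1 - cos (2 * PI * (u - w))).
Proof.
move=> r_btw e_ge0 G_per G_le G_cont; have PI_gt0 := PI_RGT_0.
have cos_r_lt1 : cos (2 * PI * r) < 1 by rewrite -cos_0; apply: cos_decreasing_1; nra.
have B_ge0 : 0 <= B by apply: Rle_trans (G_le 0); apply: Rabs_pos.
set C := _ / _; have C_ge0 : 0 <= C by apply: Rdiv_le_0_compat; lra.
have [z z_near] := exists_nearest_integer (u - w).
have -> : G u = G (u - IZR z) by rewrite -(G_per (u - IZR z) z); congr G; ring.
have -> : cos (2 * PI * (u - w)) = cos (2 * PI * (u - w - IZR z)).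
  by rewrite -[RHS](cos_period_Z _ z); congr cos; ring.
have cos_le1 := COS_bound (2 * PI * (u - w - IZR z)).
have [near|far] := Rlt_le_dec (Rabs (u - w - IZR z)) r.
  have G_near : Rabs (G (u - IZR z) - G w) <= e.
    by apply: G_cont; rewrite (_ : u - IZR z - w = u - w - IZR z) //; ring.
  by nra.
have cos_far : cos (2 * PI * (u - w - IZR z)) <= cos (2 * PI * r).
  by apply: cos_2PI_far => //; lra.
have dist_le : Rabs (G (u - IZR z) - G w) <= 2 * B.
  by move: (G_le (u - IZR z)) (G_le w); clear; split_Rabs; lra.
have CE : C * (1 - cos (2 * PI * r)) = 2 * B by rewrite /C; field; lra.
by nra.
Qed.

Lemma torus_uniform_korovkin g e : torus_uniform g -> 0 < e -> exists C, 0 <= C /\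
  forall v j u w, Rabs (g (upd v j u) - g (upd v j w)) <= e + C * (1 - cos (2 * PI * (u - w))).
Proof.
move=> g_unif e_gt0; have [B g_le] := torus_uniform_bounded g_unif.
have [r0 [r0_gt0 g_cont]] := torus_uniform_upd_continuous g_unif e_gt0.
pose r := Rmin r0 (1 / 2).
have r_btw : 0 < r <= 1 / 2 by split; [apply: Rmin_glb_lt; lra | apply: Rmin_r].
exists (2 * B / (1 - cos (2 * PI * r))); split.
  have := Rabs_pos (g (fun=> 0)); have := g_le (fun=> 0) => ? ?.
  have PI_gt0 := PI_RGT_0; apply: Rdiv_le_0_compat; first lra.
  by suff : cos (2 * PI * r) < 1; [lra | rewrite -cos_0; apply: cos_decreasing_1; nra].
move=> v j u w; apply: (korovkin_modulus (G := fun s => g (upd v j s))) => //; first lra.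
- move=> x z; pose z' k := if Nat.eqb k j then z else Z0.
  rewrite -(torus_uniform_periodic g_unif (upd v j x) z').
  congr g; apply: functional_extensionality => k; rewrite /upd /z'.
  by case: Nat.eqb; rewrite ?Rplus_0_r.
- by move=> x y xy_near; apply: g_cont; apply: Rlt_le_trans xy_near (Rmin_l _ _).
Qed.

Lemma exists_translate_cube d (v : 'I_d -> R) :
  exists z : 'I_d -> Z, in_cube (fun i => v i + IZR (z i)).
Proof.
exists (fun i => Z.opp (Int_part (v i))) => i.
by have := base_Int_part (v i); rewrite opp_IZR; lra.
Qed.

Lemma torus_continuous_unif d (f : ('I_d -> R) -> R) e : torus_continuous f -> 0 < e ->
  exists r, 0 < r /\
  forall u v : 'I_d -> R, (forall i, Rabs (u i - v i) < r) -> Rabs (f u - f v) <= e.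
Proof.
move=> [f_cont f_per] e_gt0.
have [|r [r_gt0 cover]] := cube_lebesgue (V := fun p r => forall x, ball p (2 * r) x ->
    Rabs (f x - f p) < e / 2).
  move=> p _; have [r [r_gt0 f_near]] := f_cont p (e / 2) ltac:(lra).
  by exists (r / 2); split; [lra | move=> x; rewrite (_ : 2 * _ = r); [apply: f_near | field]].
exists r; split=> // u v uv_near; have [z uz_cube] := exists_translate_cube u.
have [p [rp [_ f_near le_r uz_near]]] := cover _ uz_cube.
rewrite -(f_per u z) -(f_per v z).
have fu_near : Rabs (f (fun i => u i + IZR (z i)) - f p) < e / 2.
  by apply: f_near; apply: ball_le uz_near; lra.
have fv_near : Rabs (f (fun i => v i + IZR (z i)) - f p) < e / 2.
  apply: f_near => i; have : Rabs (u i + IZR (z i) - p i) < rp := uz_near i.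
  suff : Rabs (u i - v i) < r -> Rabs (u i + IZR (z i) - p i) < rp ->
      Rabs (v i + IZR (z i) - p i) < 2 * rp by apply; apply: uv_near.
  by move: le_r; clear; split_Rabs; lra.
by move: fu_near fv_near; clear; split_Rabs; lra.
Qed.

Lemma torus_continuous_bounded d (f : ('I_d -> R) -> R) : torus_continuous f ->
  exists B, forall v, Rabs (f v) <= B.
Proof.
move=> [f_cont f_per].
have [|r [r_gt0 cover]] := cube_lebesgue (V := fun p r => forall x, ball p r x ->
    Rabs (f x) <= / r).
  move=> p _; have [r [r_gt0 f_near]] := f_cont p 1 Rlt_0_1.
  have bound_gt0 : 0 < Rabs (f p) + 1 by have := Rabs_pos (f p); lra.
  have rad_gt0 : 0 < Rmin r (/ (Rabs (f p) + 1)).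
    by apply: Rmin_glb_lt => //; apply: Rinv_0_lt_compat.
  exists (Rmin r (/ (Rabs (f p) + 1))); split=> // x x_near.
  apply: (Rle_trans _ (Rabs (f p) + 1)); last first.
    by rewrite -[X in X <= _]Rinv_inv; apply: Rinv_le_contravar => //; apply: Rmin_r.
  suff : Rabs (f x - f p) < 1 by have := Rabs_triang_inv (f x) (f p); lra.
  by apply: f_near => i; apply: ball_le (Rmin_l _ _) _ (x_near i).
exists (/ r) => v; have [z vz_cube] := exists_translate_cube v.
have [p [rp [_ f_le le_r vz_near]]] := cover _ vz_cube.
by rewrite -(f_per v z); apply: Rle_trans (f_le _ vz_near) _; apply: Rinv_le_contravar.
Qed.

Lemma torus_continuous_uniform d (f : ('I_d -> R) -> R) :
  torus_continuous f -> torus_uniform (fun v => f (fun i : 'I_d => v i)).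
Proof.
move=> f_cont; split=> [e e_gt0|v z|].
- have [r [r_gt0 f_unif]] := torus_continuous_unif f_cont e_gt0.
  by exists r; split=> // u v uv_near; apply: f_unif.
- exact: (f_cont.2 (fun i : 'I_d => v i) (fun i => z i)).
- by have [B f_le] := torus_continuous_bounded f_cont; exists B.
Qed.

(** * Weyl's criterion *)

Definition avg_cvg (u : nat -> nat -> R) (l : R) : Prop :=
  is_lim_seq (fun n => / INR n * \rsum_(k < n) u n k) l.

Lemma avg_cvg_ext u v l : (forall n k, u n k = v n k) -> avg_cvg u l -> avg_cvg v l.
Proof. by move=> eq_uv; apply: is_lim_seq_ext => n; congr (_ * _); apply: rsum_ext. Qed.

Lemma avg_cvg_scal_l c u l : avg_cvg u l -> avg_cvg (fun n k => c * u n k) (c * l).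
Proof.
move=> u_cvg; apply: is_lim_seq_ext (is_lim_seq_mult' _ _ _ _ (is_lim_seq_const c) u_cvg) => n.
by rewrite rsum_scal_l -!Rmult_assoc (Rmult_comm c).
Qed.

Lemma avg_cvg_rsum (I : finType) (u : nat -> nat -> I -> R) (l : I -> R) :
  (forall i, avg_cvg (fun n k => u n k i) (l i)) ->
  avg_cvg (fun n k => rsum (u n k)) (rsum l).
Proof.
move=> u_cvg; apply: is_lim_seq_ext (is_lim_seq_rsum u_cvg) => n.
by rewrite rsum_exchange rsum_scal_l.
Qed.

Lemma avg_cvg_const c : avg_cvg (fun _ _ => c) c.
Proof.
apply: is_lim_seq_ext_loc (is_lim_seq_const c); exists 1%N => n n_gt0.
by rewrite rsum_const; field; apply: not_0_INR; lia.
Qed.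

Lemma avg_cvg_approx u l :
  (forall e, 0 < e -> exists v a, [/\ avg_cvg v a,
     forall n k, Rabs (u n k - v n k) <= e & Rabs (a - l) <= e]) ->
  avg_cvg u l.
Proof.
move=> approx; apply/is_lim_seq_spec => -[e e_gt0] /=.
have e4_gt0 : 0 < e / 4 by lra.
have [v [a [v_cvg uv_le al_le]]] := approx _ e4_gt0.
have [N v_near] := (is_lim_seq_spec _ _).2 v_cvg (mkposreal _ e4_gt0).
exists (maxn N 1) => n n_ge; have nR_gt0 : 0 < INR n by apply: INR_gt0; lia.
have va_lt : Rabs (/ INR n * \rsum_(k < n) v n k - a) < e / 4 by apply: v_near; lia.
have uv_avg_le : Rabs (/ INR n * \rsum_(k < n) u n k - / INR n * \rsum_(k < n) v n k) <= e / 4.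
  rewrite -Rmult_minus_distr_l -rsum_minus Rabs_mult Rabs_right; last first.
    exact/Rle_ge/Rinv_INR_ge0.
  rewrite Rmult_comm; apply/(Rle_div_l _ _ _ nR_gt0); rewrite Rmult_comm.
  by apply: Rabs_rsum_le_const => k; apply: uv_le.
by move: va_lt uv_avg_le al_le; clear; split_Rabs; lra.
Qed.

Section Weyl.
Variables (d : nat) (y : nat -> nat -> 'I_d -> R).
Implicit Types (h : 'I_d -> Z) (v : 'I_d -> R) (g : (nat -> R) -> R).

Definition dot h v : R := rsum (fun i => IZR (h i) * v i).

Definition zero_freq h : bool := [forall i, Z.eqb (h i) 0].

Definition add_freq h (j : 'I_d) (c : Z) : 'I_d -> Z :=
  fun i => Z.add (h i) (if j == i then c else Z0).

Definition trunc (j : nat) v : nat -> R :=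
  fun k => if (k < j)%N then oapp v 0 (insub k) else 0.

Lemma dot_scal_r h c v : dot h (fun i => c * v i) = c * dot h v.
Proof. by rewrite /dot -rsum_scal_l; apply: rsum_ext => i; ring. Qed.

Lemma trunc_succ (j : 'I_d) v : trunc j.+1 v = upd (trunc j v) j (v j).
Proof.
apply: functional_extensionality => k; rewrite /trunc /upd.
case: (Nat.eqb_spec k j) => [->|/eqP/negbTE ne_kj]; first by rewrite ltnSn valK.
by rewrite ltnS leq_eqVlt ne_kj.
Qed.

Lemma dot_add_freq h j c v : dot (add_freq h j c) v = dot h v + IZR c * v j.
Proof.
rewrite /dot -(rsum_delta j (IZR c * v j)) -rsum_plus; apply: rsum_ext => i.
by rewrite /add_freq plus_IZR; case: eqP => [<-|_]; ring.
Qed.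

Lemma zero_freq_add_freq h j c : h j = Z0 ->
  zero_freq (add_freq h j c) = zero_freq h && Z.eqb c 0.
Proof.
move=> hj0; apply/forallP/andP => [all0|[/forallP all0 /Z.eqb_spec ->] i].
  have addE i : add_freq h j c i = Z0 by apply/Z.eqb_spec.
  have c0 : c = Z0 by have := addE j; rewrite /add_freq hj0 eqxx.
  split; last exact/Z.eqb_spec; apply/forallP => i; apply/Z.eqb_spec.
  by have := addE i; rewrite /add_freq c0; case: eqP; lia.
by rewrite /add_freq if_same Z.add_0_r.
Qed.

Hypothesis weyl_sums : forall h th, (exists i, h i <> Z0) ->
  avg_cvg (fun n k => cos (2 * PI * dot h (y n k) + th)) 0.

Definition char_avg h th : R := if zero_freq h then cos th else 0.

Lemma Rabs_char_avg_le1 h th : Rabs (char_avg h th) <= 1.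
Proof. by rewrite /char_avg; case: ifP => _; [exact: Rabs_cos_le1 | rewrite Rabs_R0; lra]. Qed.

(* The coordinates are absorbed one at a time: [g] sees the first [j] of them,
   the frequency [h] the others. *)
Definition weyl_below (j : nat) : Prop :=
  forall g h th, torus_uniform g -> (forall i : 'I_d, (i < j)%N -> h i = Z0) ->
  avg_cvg (fun n k => g (trunc j (y n k)) * cos (2 * PI * dot h (y n k) + th))
          (char_avg h th * iter_int j g).

Lemma weyl_below0 : weyl_below 0.
Proof.
move=> g h th g_unif _; rewrite /= [char_avg h th * _]Rmult_comm.
apply: (avg_cvg_ext (u := fun n k => g (fun=> 0) * cos (2 * PI * dot h (y n k) + th))) => //.
apply: avg_cvg_scal_l; rewrite /char_avg; case: ifPn => [/forallP h_eq0|].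
  apply: avg_cvg_ext (@avg_cvg_const (cos th)) => n k.
  suff -> : dot h (y n k) = 0 by rewrite Rmult_0_r Rplus_0_l.
  rewrite /dot -[RHS](Rmult_0_l (rsum (y n k))) -rsum_scal_l; apply: rsum_ext => i.
  by rewrite (Z.eqb_spec _ _ (h_eq0 i)).
by rewrite negb_forall => /existsP [i /Z.eqb_spec hi]; apply: weyl_sums; exists i.
Qed.

Lemma weyl_fejer (j : 'I_d) g h th M t : weyl_below j -> torus_uniform g -> (0 < M)%N ->
  (forall i : 'I_d, (i <= j)%N -> h i = Z0) ->
  avg_cvg (fun n k => g (trunc j (y n k)) *
             (fejer M (2 * PI * (y n k j - t)) * cos (2 * PI * dot h (y n k) + th)))
          (char_avg h th * iter_int j g).
Proof.
move=> weyl_j g_unif M_gt0 h_low; have MR_gt0 := INR_gt0 M_gt0.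
pose c (a b : 'I_M) := Z.sub (Z.of_nat a) (Z.of_nat b).
have cE a b : IZR (c a b) = INR a - INR b by rewrite minus_IZR -!INR_IZR_INZ.
pose shifted a b n k := g (trunc j (y n k)) *
  cos (2 * PI * dot (add_freq h j (c a b)) (y n k) + (th - 2 * PI * IZR (c a b) * t)).
apply: (avg_cvg_ext (u := fun n k => / INR M * \rsum_(a < M) \rsum_(b < M) shifted a b n k)).
  move=> n k; rewrite fejer_mul_cos -Rmult_assoc [_ * / INR M]Rmult_comm Rmult_assoc.
  congr (_ * _); rewrite -rsum_scal_l; apply: rsum_ext => a.
  rewrite -rsum_scal_l; apply: rsum_ext => b; congr (_ * cos _).
  by rewrite dot_add_freq cE; ring.
have -> : char_avg h th * iter_int j g =
    / INR M * \rsum_(a < M) \rsum_(b < M) (if a == b then char_avg h th * iter_int j g else 0).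
  rewrite (rsum_ext (G := fun=> char_avg h th * iter_int j g)) => [|a]; last exact: rsum_delta.
  by rewrite rsum_const; field; lra.
apply: avg_cvg_scal_l.
apply: (avg_cvg_rsum (u := fun n k a => \rsum_(b < M) shifted a b n k)) => a.
apply: (avg_cvg_rsum (u := fun n k b => shifted a b n k)) => b.
have h_below (i : 'I_d) : (i < j)%N -> add_freq h j (c a b) i = Z0.
  move=> lt_ij; rewrite /add_freq h_low ?(ltnW lt_ij) //.
  by case: eqP lt_ij => // ->; rewrite ltnn.
have := weyl_j g (add_freq h j (c a b)) (th - 2 * PI * IZR (c a b) * t) g_unif h_below.
suff -> : char_avg (add_freq h j (c a b)) (th - 2 * PI * IZR (c a b) * t) * iter_int j g =
    if a == b then char_avg h th * iter_int j g else 0 by [].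
rewrite /char_avg zero_freq_add_freq ?h_low //; case: eqP => [<-|/eqP ne_ab].
  by rewrite /c Z.sub_diag Z.eqb_refl andbT Rmult_0_r Rmult_0_l Rminus_0_r.
suff /negbTE -> : ~~ Z.eqb (c a b) 0 by rewrite andbF Rmult_0_l.
by apply: contraNN ne_ab => /Z.eqb_spec; rewrite /c => c0; apply/eqP/ord_inj; lia.
Qed.

Lemma weyl_belowS (j : 'I_d) : weyl_below j -> weyl_below j.+1.
Proof.
move=> weyl_j g h th g_unif h_low.
pose gs s u := g (upd u j s); pose I s := iter_int j (gs s).
pose chi n k := cos (2 * PI * dot h (y n k) + th).
have gs_unif s : torus_uniform (gs s) by exact: torus_uniform_upd.
have exI a b : ex_RInt I a b.
  by apply: unif_cont_ex_RInt => e; apply: iter_int_upd_continuous.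
apply: avg_cvg_approx => e e_gt0; have e2_gt0 : 0 < e / 2 by lra.
have [C [C_ge0 g_modulus]] := torus_uniform_korovkin g_unif e2_gt0.
have [M [M_gt0 M_ge]] := exists_INR_ge (2 * C / (e / 2)); have MR_gt0 := INR_gt0 M_gt0.
have [r [r_gt0 I_cont]] := iter_int_upd_continuous j g_unif e_gt0.
have [Q1 [Q1_lt Q1_gt0]] := archimed_cor1 r r_gt0.
pose Q := maxn M Q1; have Q_gt0 : (0 < Q)%N by rewrite /Q; lia.
have lt_Qr : / INR Q < r.
  apply: Rle_lt_trans Q1_lt; apply: Rinv_le_contravar; first exact: lt_0_INR.
  by apply: leq_INR; rewrite /Q; lia.
pose term w n k := gs (INR w / INR Q) (trunc j (y n k)) *
  (fejer M (2 * PI * (y n k j - INR w / INR Q)) * chi n k).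
exists (fun n k => / INR Q * \rsum_(w < Q) term w n k),
  (/ INR Q * \rsum_(w < Q) (char_avg h th * I (INR w / INR Q))).
split.
- apply: avg_cvg_scal_l; apply: (avg_cvg_rsum (u := fun n k (w : 'I_Q) => term w n k)) => w.
  by apply: weyl_fejer => // i; apply: h_low.
- move=> n k; pose G s := gs s (trunc j (y n k)).
  rewrite trunc_succ -/(chi n k) -/(G (y n k j)).
  have -> : \rsum_(w < Q) term w n k = chi n k *
      \rsum_(w < Q) (G (INR w / INR Q) * fejer M (2 * PI * (y n k j - INR w / INR Q))).
    by rewrite -rsum_scal_l; apply: rsum_ext => w; rewrite /term /G; ring.
  have G_approx := fejer_approx (G := G) M_gt0 (leq_maxl M Q1) C_ge0 (g_modulus _ _ (y n k j)).
  have C_le : 2 * C / INR M <= e / 2.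
    by apply/Rle_div_l => //; move/Rle_div_l: M_ge => /(_ e2_gt0); lra.
  set S := \rsum_(w < Q) _ in G_approx *.
  rewrite (_ : G _ * _ - _ = chi n k * (G (y n k j) - / INR Q * S)); last ring.
  by apply: Rabs_mult_le (Rabs_cos_le1 _) _; apply: Rle_trans G_approx _; lra.
- rewrite rsum_scal_l.
  have I_approx := riemann_sum_dist exI Q_gt0 lt_Qr I_cont; set S := rsum _ in I_approx *.
  rewrite (_ : _ - _ = char_avg h th * (/ INR Q * S - RInt I 0 1)); last by rewrite /= -/I; ring.
  exact: Rabs_mult_le (Rabs_char_avg_le1 h th) I_approx.
Qed.

Lemma weyl_below_leq (j : nat) : (j <= d)%N -> weyl_below j.
Proof.
elim: j => [_|j IHj lt_jd]; first exact: weyl_below0.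
exact: (weyl_belowS (j := Ordinal lt_jd)) (IHj (ltnW lt_jd)).
Qed.

Lemma weyl_criterion f : torus_continuous f -> avg_cvg (fun n k => f (y n k)) (haar_int f).
Proof.
move=> f_cont; pose g (v : nat -> R) := f (fun i : 'I_d => v i).
have := @weyl_below_leq d (leqnn d) g (fun=> Z0) 0 (torus_continuous_uniform f_cont)
  (fun _ _ => erefl).
have -> : char_avg (fun=> Z0) 0 = 1.
  by rewrite /char_avg cos_0; case: ifPn => // /forallP [].
rewrite Rmult_1_l; apply: avg_cvg_ext => n k.
have -> : dot (fun=> Z0) (y n k) = 0.
  by rewrite /dot rsum_scal_l Rmult_0_l.
rewrite Rmult_0_r Rplus_0_r cos_0 Rmult_1_r; congr f.
by apply: functional_extensionality => i; rewrite /trunc ltn_ord valK.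
Qed.
End Weyl.

(** * Rationally non-degenerate families *)

Lemma Derive_n_eq0_succ (m : nat) (F : ('I_m -> R) -> R -> R) x j :
  (forall s, 0 <= s <= 1 -> uniformly_analytic F x s) ->
  (forall s, 0 <= s <= 1 -> Derive_n (F x) j s = 0) ->
  forall s, 0 <= s <= 1 -> Derive_n (F x) j.+1 s = 0.
Proof.
move=> F_an Dj_eq0 s s_btw.
have Dj_an := uniformly_analytic_Derive_n j (F_an s s_btw).
have [near0|[r ne0]] := uniformly_analytic_zero_dichotomy Dj_an.
  by rewrite /= (Derive_ext_loc _ (fun=> 0)) ?Derive_const.
have r_gt0 := cond_pos r; pose h := Rmin (r / 2) (1 / 2).
have h_gt0 : 0 < h by apply: Rmin_glb_lt; lra.
have [h_le_r h_le1] : h <= r / 2 /\ h <= 1 / 2 by split; [apply: Rmin_l | apply: Rmin_r].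
have off_s t : 0 <= t <= 1 -> t <> s -> Rabs (t - s) < r -> False.
  by move=> t_btw ne_ts t_near; apply: (ne0 t t_near ne_ts); apply: Dj_eq0.
exfalso; have [s_le|s_gt] := Rle_lt_dec s (1 / 2).
  by apply: (off_s (s + h)); try lra; apply: Rabs_def1; lra.
by apply: (off_s (s - h)); try lra; apply: Rabs_def1; lra.
Qed.

Section RationalCombinations.
Variables (m d : nat) (phi : ('I_m -> R) -> R -> ('I_d -> R)).
Hypothesis phi_analytic : family_analytic phi.
Implicit Types (h : 'I_d -> Z) (x : 'I_m -> R).

Definition hdot h x (t : R) : R := dot h (phi x t).

Lemma component_analytic i x s : in_cube x -> 0 <= s <= 1 ->
  uniformly_analytic (fun x t => phi x t i) x s.
Proof. by move=> x_cube s_btw; apply/analytic_at_uniformly_analytic/phi_analytic. Qed.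

Lemma hdot_analytic h x s : in_cube x -> 0 <= s <= 1 -> uniformly_analytic (hdot h) x s.
Proof.
move=> x_cube s_btw; apply: uniformly_analytic_rsum => i.
by apply: uniformly_analytic_scal; apply: component_analytic.
Qed.

Lemma Derive_n_hdot h x k s : in_cube x -> 0 <= s <= 1 ->
  Derive_n (hdot h x) k s = hdot_deriv (phi x) h k s.
Proof.
move=> x_cube s_btw; apply: (Derive_n_rsum _ (F := fun i x t => phi x t i)) => i.
exact: component_analytic.
Qed.

Lemma rnd_index_leq x i j : in_cube x -> (1 <= i)%N -> (i <= j)%N ->
  rnd_index (phi x) j -> rnd_index (phi x) i.
Proof.
move=> x_cube i_ge1 le_ij [_ nz_j]; split=> // h h_ne0.
have [t [t_btw nz_t]] := nz_j h h_ne0.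
apply: NNPP => no_nz; apply: nz_t; rewrite -Derive_n_hdot //.
suff vanish k s : 0 <= s <= 1 -> Derive_n (hdot h x) (i + k)%N s = 0.
  by rewrite -(subnKC le_ij); apply: vanish.
elim: k s => [|k IHk] s s_btw; last first.
  by rewrite addnS; apply: Derive_n_eq0_succ => // u; apply: hdot_analytic.
by rewrite addn0 Derive_n_hdot //; apply: NNPP => nz; apply: no_nz; exists s.
Qed.

Lemma rnd_index_below_order x k q : in_cube x -> (1 <= q)%N ->
  curve_rnd_order (phi x) k -> enat_le (Some q) k -> rnd_index (phi x) q.
Proof.
move=> x_cube q_ge1 [_ order_least] le_qk.
have [j [le_qj nz_j]] : exists j, (q <= j)%N /\ rnd_index (phi x) j.
  apply: NNPP => no_j.
  have : enat_le k (Some q.-1).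
    apply: order_least => j nz_j /=; have [lt_jq|le_qj] := ltnP j q; first lia.
    by case: no_j; exists j.
  by case: k le_qk {order_least} => [k|] //=; lia.
exact: rnd_index_leq le_qj nz_j.
Qed.

Lemma weyl_sums_cvg0 q (rho : nat -> R) (xs : nat -> 'I_m -> R) h th : (0 < q)%N ->
  (forall x, in_cube x -> rnd_index (phi x) q) ->
  is_lim_seq rho p_infty -> is_lim_seq (fun n => rho n / INR n ^ q) 0 ->
  (forall n, in_cube (xs n)) -> (exists i, h i <> Z0) ->
  avg_cvg (fun n k => cos (2 * PI *
    dot h (fun i => rho n * phi (xs n) (INR k.+1 / INR n) i) + th)) 0.
Proof.
move=> q_gt0 nz_q rho_infty rho_small xs_cube h_ne0.
pose F x t := 2 * PI * hdot h x t.
have F_an x s : in_cube x -> 0 <= s <= 1 -> uniformly_analytic F x s.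
  by move=> x_cube s_btw; apply: uniformly_analytic_scal; apply: hdot_analytic.
have F_nz x : in_cube x -> exists t, 0 <= t <= 1 /\ Derive_n (F x) q t <> 0.
  move=> x_cube; have [t [t_btw nz_t]] := (nz_q x x_cube).2 h h_ne0; exists t; split=> //.
  rewrite /F Derive_n_scal_l Derive_n_hdot //.
  by apply: Rmult_integral_contrapositive_currified => //; have := PI_RGT_0; lra.
pose v n k := cos (rho n * F (xs n) (INR k / INR n) + th).
apply: (avg_cvg_ext (u := fun n k => v n k.+1)) => [n k|].
  by rewrite /v /F dot_scal_r; congr cos; rewrite /hdot; ring.
apply/is_lim_seq_spec => -[e e_gt0] /=; have e4_gt0 : 0 < e / 4 by lra.
have [N sum_le] := cos_sum_uniform q_gt0 F_an rho_infty rho_small F_nz e4_gt0.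
have [N2 [N2_gt0 N2_ge]] := exists_INR_ge (4 / e).
exists (maxn N N2) => n n_ge; have nR_gt0 : 0 < INR n by apply: INR_gt0; lia.
have n_large : 4 <= INR n * e.
  by apply/(Rle_div_l _ _ _ e_gt0)/(Rle_trans _ _ _ N2_ge)/leq_INR; lia.
have main_le : Rabs (\rsum_(k < n) v n k) <= e / 4 * INR n by apply: sum_le => //; lia.
have shift_le : Rabs (\rsum_(k < n) v n k.+1 - \rsum_(k < n) v n k) <= 2 * (INR 1 * 1).
  by apply: (rsum_shift_dist n 1 (f := v n)) => k; apply: Rabs_cos_le1.
rewrite Rminus_0_r Rabs_mult Rabs_right; last exact/Rle_ge/Rinv_INR_ge0.
rewrite Rmult_comm; apply/(Rlt_div_l _ _ _ nR_gt0).
have := Rabs_triang_inv (\rsum_(k < n) v n k.+1) (\rsum_(k < n) v n k).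
by rewrite /= in shift_le; nra.
Qed.
End RationalCombinations.

Lemma exists_growth_order (kappa : enat) (rho : nat -> R) :
  enat_le (Some 2%N) kappa ->
  (forall k : nat, kappa = Some k -> is_lim_seq (fun n => rho n / INR n ^ k) 0) ->
  (kappa = None -> exists l : nat, is_lim_seq (fun n => rho n / INR n ^ l) 0) ->
  exists q, [/\ (0 < q)%N, enat_le (Some q) kappa & is_lim_seq (fun n => rho n / INR n ^ q) 0].
Proof.
case: kappa => [k|] le2 rho_fin rho_inf.
  by exists k; split; [exact: ltnW | exact: leqnn | exact: rho_fin].
have [l rho_l] := rho_inf erefl; exists l.+1; split=> //.
have inv_cvg0 : is_lim_seq (fun n => / INR n) 0.
  exact: (is_lim_seq_inv _ p_infty is_lim_seq_INR).
have := is_lim_seq_mult' _ _ _ _ rho_l inv_cvg0; rewrite Rmult_0_l.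
by apply: is_lim_seq_ext => n; rewrite -tech_pow_Rmult /Rdiv Rinv_mult; ring.
Qed.

Lemma enat_le_trans a b c : enat_le a b -> enat_le b c -> enat_le a c.
Proof. by case: a b c => [a|] [b|] [c|] //=; apply: leq_trans. Qed.

Lemma rsum_nat1 n (u : nat -> R) : rsum_nat 1 n.+1 u = \rsum_(k < n) u k.+1.
Proof. by rewrite /rsum_nat big_add1 big_mkord. Qed.

Theorem theorem1p2 (m d : nat) (phi : ('I_m -> R) -> R -> ('I_d -> R))
  (kappa : enat) (rho : nat -> R) (xs : nat -> ('I_m -> R)) :
  family_analytic phi ->
  family_rnd_order phi kappa ->
  enat_le (Some 2%nat) kappa ->
  is_lim_seq rho p_infty ->
  (forall k : nat, kappa = Some k ->
     is_lim_seq (fun n => rho n / (INR n ^ k)) 0) ->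
  (kappa = None ->
     exists l : nat, is_lim_seq (fun n => rho n / (INR n ^ l)) 0) ->
  (forall n, in_cube (xs n)) ->
  forall f : ('I_d -> R) -> R, torus_continuous f ->
    is_lim_seq
      (fun n : nat => / INR n *
         rsum_nat 1 n.+1
           (fun k => f (fun i => rho n * phi (xs n) (INR k / INR n) i)))
      (haar_int f).
Proof.
move=> phi_an [ord [ord_x [kappa_le _]]] kappa_ge2 rho_infty rho_fin rho_inf xs_cube f f_cont.
have [q [q_gt0 le_q_kappa rho_small]] := exists_growth_order kappa_ge2 rho_fin rho_inf.
have rnd_q x : in_cube x -> rnd_index (phi x) q.
  move=> x_cube; apply: (rnd_index_below_order phi_an x_cube q_gt0 (ord_x x x_cube)).
  exact: enat_le_trans le_q_kappa (kappa_le x x_cube).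
pose y n k i := rho n * phi (xs n) (INR k.+1 / INR n) i.
have weyl_sums h th : (exists i, h i <> Z0) ->
    avg_cvg (fun n k => cos (2 * PI * dot h (y n k) + th)) 0.
  exact: (weyl_sums_cvg0 phi_an th q_gt0 rnd_q rho_infty rho_small xs_cube).
by apply: is_lim_seq_ext (weyl_criterion weyl_sums f_cont) => n; rewrite rsum_nat1.
Qed.
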